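(* The Hilbert matrix operator $\mathcal{H}$ is bounded from $H^\infty$ to the Bloch space $\mathcal{B}$, and $\|\mathcal{H}\|_{H^\infty\to\mathcal{B}}=3$.
   Context: Let $\mathbb{D}=\{z\in\mathbb{C}:|z|<1\}$ and let $H(\mathbb{D})$ be the space of all analytic functions on $\mathbb{D}$. $H^\infty$ is the space of $f\in H(\mathbb{D})$ with $\|f\|_\infty=\sup_{z\in\mathbb{D}}|f(z)|<\infty$. The Bloch space $\mathcal{B}$ consists of all $f\in H(\mathbb{D})$ with $$\|f\|_{\mathcal{B}}=|f(0)|+\sup_{z\in\mathbb{D}}(1-|z|^2)|f'(z)|<\infty.$$ For $f(z)=\sum_{n=0}^\infty a_nz^n\in H(\mathbb{D})$, the Hilbert matrix operator is $$\mathcal{H}(f)(z)=\sum_{n=0}^\infty\left(\sum_{k=0}^\infty\frac{a_k}{n+k+1}\right)z^n,\quad z\in\mathbb{D},$$ whenever the right-hand side makes sense and defines an analytic function in $\mathbb{D}$. The operator norm is $\|\mathcal{H}\|_{H^\infty\to\mathcal{B}}=\sup\{\|\mathcal{H}(f)\|_{\mathcal{B}}: f\in H^\infty,\ \|f\|_\infty\le 1\}$. *)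

(* Defs.v *)
From Stdlib Require Import Reals.
From Coquelicot Require Import Coquelicot.
Open Scope R_scope.

(* Functions on the unit disc D are total functions [C -> C]; all the notions
   below depend only on their values at the points of D. *)
Definition disc (z : C) : Prop := Cmod z < 1.

Definition analytic (f : C -> C) : Prop :=
  forall z : C, disc z -> @ex_derive C_AbsRing C_NormedModule f z.

Definition Hinf_norm (f : C -> C) : Rbar :=
  Lub_Rbar (fun x : R => exists z : C, disc z /\ x = Cmod (f z)).

Definition in_Hinf (f : C -> C) : Prop :=
  analytic f /\ Rbar_lt (Hinf_norm f) p_infty.

(* Coquelicot's [C_derive] is a limit along the horizontal direction only; it is
   the complex derivative for analytic f ([C_derive_correct]), the only case in
   which this norm is used. *)
Definition bloch_norm (f : C -> C) : Rbar :=
  Rbar_plus (Finite (Cmod (f (RtoC 0))))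
    (Lub_Rbar (fun x : R => exists z : C,
       disc z /\ x = (1 - Cmod z ^ 2) * Cmod (C_derive f z))).

Definition in_bloch (f : C -> C) : Prop :=
  analytic f /\ Rbar_lt (bloch_norm f) p_infty.

Definition power_series_on_disc (a : nat -> C) (f : C -> C) : Prop :=
  forall z : C, disc z -> @is_pseries C_AbsRing C_NormedModule a z (f z).

(* [hilbert f g]: H(f) is defined and coincides with g on D.  The Hilbert
   operator is partial on analytic functions, hence the relational form; g is
   unique on D because Taylor coefficients and sums of series are unique. *)
Definition hilbert (f g : C -> C) : Prop :=
  analytic f /\ analytic g /\
  exists a b : nat -> C,
    power_series_on_disc a f /\
    (forall n : nat,
       @is_series C_AbsRing C_NormedModule
         (fun k : nat => Cdiv (a k) (RtoC (INR (n + k + 1)))) (b n)) /\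
    power_series_on_disc b g.

Definition hilbert_op_norm : Rbar :=
  Rbar_lub (fun x : Rbar => exists f g : C -> C,
    in_Hinf f /\ Rbar_le (Hinf_norm f) (Finite 1) /\
    hilbert f g /\ x = bloch_norm g).

(* Main.v *)
Require Import Defs.
From Stdlib Require Import Reals Lra Lia Psatz ClassicalEpsilon.
From Coquelicot Require Import Coquelicot.
(* [disc] is the unit disc, not the [disc] of the topology of the line. *)
Import Defs.
Open Scope R_scope.

(** Let [|f| <= M] on the disc, with Taylor coefficients [a_k].  The [n]-th
    coefficient of [H f] is [b_n = sum_k a_k / (n + k + 1)], which is
    [int_0^1 t^n f(t) dt] by Abel's theorem; hence [|b_n| <= M / (n + 1)]
    ([hilbert_coeff_bound]).  This bound gives the norm estimate:
    [|H f (0)| = |b_0| <= M], and since [n |b_n| <= M],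
    [[
      (1 - |z|^2) |(H f)'(z)| <= (1 - |z|^2) M sum_(n >= 1) |z|^(n - 1)
                              = (1 + |z|) M <= 2 M,
    ]]
    so the Bloch norm of [H f] is at most [3 M] ([bloch_norm_le]).  The constant
    function 1 attains 3: there [b_n = 1 / (n + 1)], the value at 0 is 1, and
    [(1 - r^2) sum_n n r^(n-1) / (n + 1)] tends to 2 as [r] tends to 1, because
    [n / (n + 1)] tends to 1 ([inv_succ_bloch_norm_ge]).

    That [H f] exists rests on two facts about a bounded function [f] that is
    complex differentiable at each point of the disc, with no continuity of the
    derivative assumed: [f] is the sum of a power series ([taylor_on_disc]), and
    [sum_k |a_k|^2 <= M^2] ([taylor_coeff_square_sum]).  The second, with
    [|a_k| / (k + 1) <= |a_k|^2 + 1 / (k + 1)^2], makes each [b_n] converge.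

    Both facts come from Fourier analysis on circles.  In the variable
    [log w = x + i y], the form [f(w) w^n dw / w] is closed and has period
    [2 pi i], so Goursat's theorem on rectangles ([goursat_rectangle]) shows that
    the mean of [f(w) w^n] over [|w| = exp x] does not depend on [x].  This says
    that the [j]-th Fourier coefficient of [f] on the circle of radius [r] is
    [a_j r^j] for [j >= 0] and, letting [r] tend to 0, that it vanishes for
    [j < 0].  Bessel's inequality on circles of radius close to 1 gives the square
    sum.  For the convergence at [z], write [f(w) - f(z) = (w - z) q(w)] with [q]
    continuous: the Fourier coefficients of the left side are differences of
    those of [q], the partial sums of [sum_j a_j z^j] telescope to [f(z)] plus a
    single Fourier coefficient of [q], and the latter tends to 0 by Bessel. *)

(** * Complex numbers, derivatives and series *)

Lemma im_le_Cmod (c : C) : Rabs (Im c) <= Cmod c.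
Proof. exact (Rle_trans _ _ _ (Rmax_r _ _) (Rmax_Cmod c)). Qed.

Lemma Cmod_le_Re_Im (c : C) : Cmod c <= Rabs (Re c) + Rabs (Im c).
Proof.
  replace c with (RtoC (Re c) + Ci * RtoC (Im c))%C at 1
    by (destruct c; unfold Ci, RtoC, Cplus, Cmult; simpl; f_equal; ring).
  eapply Rle_trans; [apply Cmod_triangle|].
  rewrite Cmod_mult, Cmod_Ci, !Cmod_R; lra.
Qed.

Lemma Cmod_minus_sym (x y : C) : Cmod (x - y) = Cmod (y - x).
Proof. rewrite <- Cmod_opp; f_equal; ring. Qed.

Lemma Cmod_triangle_minus (x y : C) : Cmod x - Cmod y <= Cmod (x - y).
Proof.
  assert (H := Cmod_triangle (x - y) y).
  replace (x - y + y)%C with x in H by ring. lra.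
Qed.

Lemma is_derive_C_bound (f : C -> C) (z l : C) :
  @is_derive C_AbsRing C_NormedModule f z l ->
  forall eps : R, 0 < eps -> exists d : R, 0 < d /\
    forall w : C, Cmod (w - z) < d ->
      Cmod (f w - f z - l * (w - z)) <= eps * Cmod (w - z).
Proof.
  intros [_ H] eps He.
  specialize (H z (fun P HP => HP) (mkposreal eps He)).
  destruct H as [d Hd].
  exists d; split; [apply cond_pos|].
  intros w Hw. specialize (Hd w Hw). simpl in Hd.
  replace (f w - f z - l * (w - z))%C
    with (minus (minus (f w) (f z)) (scal (minus w z) l)).
  - exact Hd.
  - unfold minus, plus, opp, scal, mult; simpl. unfold mult; simpl. ring.
Qed.

Lemma bound_is_derive_C (f : C -> C) (z l : C) :
  (forall eps : R, 0 < eps -> exists d : R, 0 < d /\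
    forall w : C, Cmod (w - z) < d ->
      Cmod (f w - f z - l * (w - z)) <= eps * Cmod (w - z)) ->
  @is_derive C_AbsRing C_NormedModule f z l.
Proof.
  intros H; split; [apply (@is_linear_scal_l C_AbsRing C_NormedModule)|].
  intros x Hx eps.
  assert (Exz : z = x) by
    exact (@is_filter_lim_locally_unique C_AbsRing (AbsRing_NormedModule C_AbsRing) z x Hx).
  subst x.
  destruct (H eps (cond_pos eps)) as [d [Hd K]].
  exists (mkposreal d Hd). intros w Hw.
  specialize (K w Hw).
  replace (f w - f z - l * (w - z))%C
    with (minus (minus (f w) (f z)) (scal (minus w z) l)) in K.
  - exact K.
  - unfold minus, plus, opp, scal, mult; simpl. unfold mult; simpl. ring.
Qed.

Lemma is_series_C_bound (u : nat -> C) (l : C) :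
  @is_series C_AbsRing C_NormedModule u l ->
  forall eps : R, 0 < eps -> exists N : nat, forall n : nat, (N <= n)%nat ->
    Cmod (sum_n u n - l) < eps.
Proof.
  intros H eps He.
  destruct (H (fun x => Cmod (x - l) < eps)) as [N HN].
  - apply (@locally_le_locally_norm C_AbsRing C_NormedModule).
    exists (mkposreal eps He); intros y Hy; exact Hy.
  - exists N; exact HN.
Qed.

Lemma bound_is_series_C (u : nat -> C) (l : C) :
  (forall eps : R, 0 < eps -> exists N : nat, forall n : nat, (N <= n)%nat ->
    Cmod (sum_n u n - l) < eps) ->
  @is_series C_AbsRing C_NormedModule u l.
Proof.
  intros H P HP.
  apply (@locally_norm_le_locally C_AbsRing C_NormedModule) in HP.
  destruct HP as [eps HP].
  destruct (H eps (cond_pos eps)) as [N HN].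
  exists N; intros n Hn; apply HP; exact (HN n Hn).
Qed.

Lemma sum_n_Re (u : nat -> C) (n : nat) : Re (sum_n u n) = sum_n (fun k => Re (u k)) n.
Proof.
  induction n as [|n IH]; [now rewrite !sum_O|rewrite !sum_Sn, <- IH; reflexivity].
Qed.

Lemma sum_n_Im (u : nat -> C) (n : nat) : Im (sum_n u n) = sum_n (fun k => Im (u k)) n.
Proof.
  induction n as [|n IH]; [now rewrite !sum_O|rewrite !sum_Sn, <- IH; reflexivity].
Qed.

Lemma bound_is_series_R (u : nat -> R) (l : R) :
  (forall eps : R, 0 < eps -> exists N : nat, forall n : nat, (N <= n)%nat ->
    Rabs (sum_n u n - l) < eps) -> is_series u l.
Proof.
  intros H P [eps HP].
  destruct (H eps (cond_pos eps)) as [N HN].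
  exists N; intros n Hn; apply HP; exact (HN n Hn).
Qed.

Lemma is_series_Re (u : nat -> C) (l : C) :
  @is_series C_AbsRing C_NormedModule u l -> is_series (fun k => Re (u k)) (Re l).
Proof.
  intros H. apply bound_is_series_R; intros eps He.
  destruct (is_series_C_bound u l H eps He) as [N HN].
  exists N; intros n Hn. eapply Rle_lt_trans; [|apply (HN n Hn)].
  rewrite <- sum_n_Re. apply (re_le_Cmod (sum_n u n - l)).
Qed.

Lemma is_series_R_bound (u : nat -> R) (l : R) :
  is_series u l -> forall eps : R, 0 < eps -> exists N : nat, forall n : nat, (N <= n)%nat ->
    Rabs (sum_n u n - l) < eps.
Proof.
  intros H eps He. destruct (H (fun x => Rabs (x - l) < eps)) as [N HN].
  - exists (mkposreal eps He); intros y Hy; exact Hy.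
  - exists N; exact HN.
Qed.

Lemma is_series_C_of_Re_Im (u : nat -> C) (l : C) :
  is_series (fun k => Re (u k)) (Re l) -> is_series (fun k => Im (u k)) (Im l) ->
  @is_series C_AbsRing C_NormedModule u l.
Proof.
  intros Hr Hi; apply bound_is_series_C; intros eps He.
  destruct (is_series_R_bound _ _ Hr (eps/2)) as [N1 H1]; [lra|].
  destruct (is_series_R_bound _ _ Hi (eps/2)) as [N2 H2]; [lra|].
  exists (max N1 N2); intros n Hn.
  eapply Rle_lt_trans; [apply Cmod_le_Re_Im|].
  specialize (H1 n ltac:(lia)); specialize (H2 n ltac:(lia)).
  rewrite <- sum_n_Re in H1. rewrite <- sum_n_Im in H2.
  change (Re (sum_n u n - l)) with (Re (sum_n u n) - Re l).
  change (Im (sum_n u n - l)) with (Im (sum_n u n) - Im l). lra.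
Qed.

Lemma ex_series_nonneg_bounded (u : nat -> R) (B : R) :
  (forall n, 0 <= u n) -> (forall n, sum_n u n <= B) -> ex_series u.
Proof.
  intros H HB. destruct (ex_finite_lim_seq_incr (sum_n u) B) as [l Hl].
  - intros n. rewrite sum_Sn. unfold plus; simpl. specialize (H (S n)). lra.
  - exact HB.
  - exists l; exact Hl.
Qed.

(** * Goursat's theorem for rectangles *)

Lemma nested_dyadic_point (s : nat -> R) (a : R) :
  0 <= a ->
  (forall n, s n <= s (S n) /\ s (S n) + a / 2 ^ (S n) <= s n + a / 2 ^ n) ->
  exists u, forall n, s n <= u <= s n + a / 2 ^ n.
Proof.
  intros Ha Hs.
  assert (Hinc : forall n k, s n <= s (n + k)%nat /\
            s (n + k)%nat + a / 2 ^ (n + k) <= s n + a / 2 ^ n).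
  { intros n k; induction k as [|k IH].
    - rewrite Nat.add_0_r; lra.
    - replace (n + S k)%nat with (S (n + k)) by lia. specialize (Hs (n + k)%nat). lra. }
  assert (Hpos : forall n, 0 <= a / 2 ^ n).
  { intros n; apply Rmult_le_pos; [lra|]. left; apply Rinv_0_lt_compat, pow_lt; lra. }
  assert (Hcross : forall m n, s m <= s n + a / 2 ^ n).
  { intros m n. destruct (Hinc m (max m n - m)%nat) as [H1 _].
    destruct (Hinc n (max m n - n)%nat) as [_ H2].
    replace (m + (max m n - m))%nat with (max m n) in H1 by lia.
    replace (n + (max m n - n))%nat with (max m n) in H2 by lia.
    specialize (Hpos (max m n)). lra. }
  destruct (completeness (fun x => exists n, x = s n)) as [u [Hub Hlub]].
  - exists (s 0%nat + a / 2 ^ 0). intros x [m ->]; apply Hcross.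
  - exists (s 0%nat), 0%nat; reflexivity.
  - exists u; intros n; split.
    + apply Hub; exists n; reflexivity.
    + apply Hlub; intros x [m ->]; apply Hcross.
Qed.

(** Compactness of a rectangle, in the form used by Goursat's argument.  If the
    whole rectangle failed, a failing quarter could be chosen at each scale, and
    these cells would shrink to a point all of whose small cells satisfy [T]. *)
Lemma dyadic_bisection (T : nat -> R -> R -> Prop) (x0 y0 a b : R) :
  0 <= a -> 0 <= b ->
  (forall n x y,
     x0 <= x -> x + a / 2 ^ n <= x0 + a -> y0 <= y -> y + b / 2 ^ n <= y0 + b ->
     T (S n) x y -> T (S n) (x + a / 2 ^ (S n)) y ->
     T (S n) x (y + b / 2 ^ (S n)) ->
     T (S n) (x + a / 2 ^ (S n)) (y + b / 2 ^ (S n)) -> T n x y) ->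
  (forall u v, x0 <= u <= x0 + a -> y0 <= v <= y0 + b ->
     exists N, forall n x y, (N <= n)%nat ->
     x0 <= x -> x + a / 2 ^ n <= x0 + a -> y0 <= y -> y + b / 2 ^ n <= y0 + b ->
     x <= u <= x + a / 2 ^ n -> y <= v <= y + b / 2 ^ n -> T n x y) ->
  T 0%nat x0 y0.
Proof.
  intros Ha Hb Hstep Hloc.
  destruct (excluded_middle_informative (T 0%nat x0 y0)) as [|Hnot]; [assumption|exfalso].
  pose (next := fun n (p : R * R) =>
    let '(x, y) := p in
    let x' := x + a / 2 ^ (S n) in let y' := y + b / 2 ^ (S n) in
    if excluded_middle_informative (T (S n) x y) then
      if excluded_middle_informative (T (S n) x' y) then
        if excluded_middle_informative (T (S n) x y') then (x', y') else (x, y')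
      else (x', y)
    else (x, y)).
  pose (s := fix s n := match n with O => (x0, y0) | S m => next m (s m) end).
  assert (Hhalf : forall c n, c / 2 ^ n = c / 2 ^ (S n) + c / 2 ^ (S n)).
  { intros c n; simpl; field; apply pow_nonzero; lra. }
  assert (Hpos : forall c n, 0 <= c -> 0 <= c / 2 ^ n).
  { intros c n Hc; apply Rmult_le_pos; [lra|]. left; apply Rinv_0_lt_compat, pow_lt; lra. }
  assert (Hmove : forall n,
    (fst (s (S n)) = fst (s n) \/ fst (s (S n)) = fst (s n) + a / 2 ^ (S n)) /\
    (snd (s (S n)) = snd (s n) \/ snd (s (S n)) = snd (s n) + b / 2 ^ (S n))).
  { intros n. change (s (S n)) with (next n (s n)). destruct (s n) as [x y]; unfold next; cbv zeta.
    destruct (excluded_middle_informative (T (S n) x y)); [|simpl fst; simpl snd; auto].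
    destruct (excluded_middle_informative (T (S n) (x + a / 2 ^ (S n)) y));
      [|simpl fst; simpl snd; auto].
    destruct (excluded_middle_informative (T (S n) x (y + b / 2 ^ (S n))));
      simpl fst; simpl snd; auto. }
  assert (Hnx : forall n, fst (s n) <= fst (s (S n)) /\
             fst (s (S n)) + a / 2 ^ (S n) <= fst (s n) + a / 2 ^ n).
  { intros n. destruct (Hmove n) as [[-> | ->] _]; rewrite (Hhalf a n);
      specialize (Hpos a (S n) Ha); lra. }
  assert (Hny : forall n, snd (s n) <= snd (s (S n)) /\
             snd (s (S n)) + b / 2 ^ (S n) <= snd (s n) + b / 2 ^ n).
  { intros n. destruct (Hmove n) as [_ [-> | ->]]; rewrite (Hhalf b n);
      specialize (Hpos b (S n) Hb); lra. }
  assert (Hbox : forall n, x0 <= fst (s n) /\ fst (s n) + a / 2 ^ n <= x0 + a /\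
             y0 <= snd (s n) /\ snd (s n) + b / 2 ^ n <= y0 + b).
  { induction n as [|n IH].
    - simpl; lra.
    - specialize (Hnx n); specialize (Hny n); lra. }
  assert (Hfail : forall n, ~ T n (fst (s n)) (snd (s n))).
  { induction n as [|n IH]; [exact Hnot|].
    specialize (Hbox n). change (s (S n)) with (next n (s n)).
    destruct (s n) as [x y]; unfold next; cbv zeta; cbn [fst snd] in *.
    destruct (excluded_middle_informative (T (S n) x y)); [|cbn [fst snd]; assumption].
    destruct (excluded_middle_informative (T (S n) (x + a / 2 ^ (S n)) y)); [|cbn [fst snd]; assumption].
    destruct (excluded_middle_informative (T (S n) x (y + b / 2 ^ (S n)))); [|cbn [fst snd]; assumption].
    intros H4; cbn [fst snd] in H4; apply IH, Hstep; tauto. }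
  destruct (nested_dyadic_point (fun n => fst (s n)) a Ha Hnx) as [u Hu].
  destruct (nested_dyadic_point (fun n => snd (s n)) b Hb Hny) as [v Hv].
  destruct (Hloc u v) as [N HN].
  - specialize (Hu 0%nat); simpl in Hu; lra.
  - specialize (Hv 0%nat); simpl in Hv; lra.
  - destruct (Hbox N) as [H1 [H2 [H3 H4]]].
    exact (Hfail N (HN N _ _ (le_n N) H1 H2 H3 H4 (Hu N) (Hv N))).
Qed.

(** The line integral of [P dx + Q dy] around the rectangle.  Opposite sides share
    one integral, so that first-order increments of [P] and [Q] appear under the
    integral sign and their linear parts are constants. *)
Definition boundary_integral (P Q : R -> R -> R) (x1 x2 y1 y2 : R) : R :=
  RInt (fun y => Q x2 y - Q x1 y) y1 y2 - RInt (fun x => P x y2 - P x y1) x1 x2.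

Lemma ex_RInt_minus_of_continuous (f g : R -> R) (a b : R) :
  a <= b ->
  (forall t, a <= t <= b -> continuous f t) -> (forall t, a <= t <= b -> continuous g t) ->
  ex_RInt (fun t => f t - g t) a b.
Proof.
  intros Hab Hf Hg; apply (@ex_RInt_continuous R_CompleteNormedModule); intros t Ht.
  rewrite Rmin_left, Rmax_right in Ht by lra.
  apply (@continuous_minus R_UniformSpace R_AbsRing R_NormedModule f g); auto.
Qed.

Lemma ex_RInt_of_continuous (f : R -> R) (a b : R) :
  a <= b -> (forall t, a <= t <= b -> continuous f t) -> ex_RInt f a b.
Proof.
  intros Hab Hf; apply (@ex_RInt_continuous R_CompleteNormedModule); intros t Ht.
  rewrite Rmin_left, Rmax_right in Ht by lra. auto.
Qed.

Lemma RInt_minus_R (f g : R -> R) (a b : R) :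
  ex_RInt f a b -> ex_RInt g a b ->
  RInt (fun t => f t - g t) a b = RInt f a b - RInt g a b.
Proof. exact (@RInt_minus R_CompleteNormedModule f g a b). Qed.

Lemma boundary_integral_split (P Q : R -> R -> R) (x1 x2 x3 y1 y2 y3 : R) :
  x1 <= x2 <= x3 -> y1 <= y2 <= y3 ->
  (forall x y, x1 <= x <= x3 -> y1 <= y <= y3 -> continuous (fun t => P t y) x) ->
  (forall x y, x1 <= x <= x3 -> y1 <= y <= y3 -> continuous (fun t => Q x t) y) ->
  boundary_integral P Q x1 x3 y1 y3 =
    boundary_integral P Q x1 x2 y1 y2 + boundary_integral P Q x2 x3 y1 y2 +
    (boundary_integral P Q x1 x2 y2 y3 + boundary_integral P Q x2 x3 y2 y3).
Proof.
  intros Hx Hy HP HQ; unfold boundary_integral.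
  rewrite !RInt_minus_R;
    try (apply ex_RInt_of_continuous; [lra|]; intros t Ht;
         first [apply HP; lra | apply HQ; lra]).
  assert (CP : forall y, y1 <= y <= y3 ->
    RInt (fun x => P x y) x1 x3 = RInt (fun x => P x y) x1 x2 + RInt (fun x => P x y) x2 x3).
  { intros y Hy'; symmetry; apply (@RInt_Chasles R_CompleteNormedModule);
      (apply ex_RInt_of_continuous; [lra|]; intros t Ht; apply HP; lra). }
  assert (CQ : forall x, x1 <= x <= x3 ->
    RInt (Q x) y1 y3 = RInt (Q x) y1 y2 + RInt (Q x) y2 y3).
  { intros x Hx'; symmetry; apply (@RInt_Chasles R_CompleteNormedModule);
      (apply ex_RInt_of_continuous; [lra|]; intros t Ht; apply HQ; lra). }
  rewrite !CP, !CQ by lra. ring.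
Qed.

Lemma differentiable_pt_lim_continuous_1 (f : R -> R -> R) (x y lx ly : R) :
  differentiable_pt_lim f x y lx ly -> continuous (fun t => f t y) x.
Proof.
  intros H. apply continuity_pt_filterlim.
  apply derivable_continuous_pt. exists (lx * 1 + ly * 0).
  apply (derivable_pt_lim_comp_2d f (fun t => t) (fun _ => y));
    [exact H|apply derivable_pt_lim_id|apply derivable_pt_lim_const].
Qed.

Lemma differentiable_pt_lim_continuous_2 (f : R -> R -> R) (x y lx ly : R) :
  differentiable_pt_lim f x y lx ly -> continuous (fun t => f x t) y.
Proof.
  intros H. apply continuity_pt_filterlim.
  apply derivable_continuous_pt. exists (lx * 0 + ly * 1).
  apply (derivable_pt_lim_comp_2d f (fun _ => x) (fun t => t));
    [exact H|apply derivable_pt_lim_const|apply derivable_pt_lim_id].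
Qed.

(** The linear parts of [P] and [Q] at a point contribute [(Q_x - P_y) h k = 0]
    to the boundary integral over an [h] by [k] cell, so only the error of the
    first-order approximation is left; it is [o(h + k)] along a boundary of
    length [2 (h + k)]. *)
Lemma boundary_integral_small_cell (P Q : R -> R -> R) (u v px c qy eps : R) :
  0 < eps -> differentiable_pt_lim P u v px c -> differentiable_pt_lim Q u v c qy ->
  exists d, 0 < d /\ forall x y h k, 0 <= h < d -> 0 <= k < d ->
    x <= u <= x + h -> y <= v <= y + k ->
    (forall s t, x <= s <= x + h -> y <= t <= y + k -> continuous (fun r => P r t) s) ->
    (forall s t, x <= s <= x + h -> y <= t <= y + k -> continuous (fun r => Q s r) t) ->
    Rabs (boundary_integral P Q x (x + h) y (y + k)) <= eps * (h + k) ^ 2.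
Proof.
  intros He HP HQ.
  pose (e := eps / 2). assert (He' : 0 < e) by (unfold e; lra).
  destruct (HP (mkposreal e He')) as [d1 H1].
  destruct (HQ (mkposreal e He')) as [d2 H2].
  exists (Rmin d1 d2); split; [apply Rmin_glb_lt; apply cond_pos|].
  intros x y h k Hh Hk Hu Hv CP CQ.
  assert (Ld1 := Rmin_l d1 d2). assert (Ld2 := Rmin_r d1 d2).
  assert (Hin : forall s t, x <= s <= x + h -> y <= t <= y + k ->
    Rabs (s - u) <= h /\ Rabs (t - v) <= k).
  { intros s t Hs Ht; split; apply Rabs_le; lra. }
  assert (EP : forall s t, x <= s <= x + h -> y <= t <= y + k ->
    Rabs (P s t - P u v - (px * (s - u) + c * (t - v))) <= e * (h + k)).
  { intros s t Hs Ht; destruct (Hin s t Hs Ht).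
    eapply Rle_trans; [apply H1; lra|]; simpl.
    apply Rmult_le_compat_l; [lra|]; apply Rmax_lub; lra. }
  assert (EQ : forall s t, x <= s <= x + h -> y <= t <= y + k ->
    Rabs (Q s t - Q u v - (c * (s - u) + qy * (t - v))) <= e * (h + k)).
  { intros s t Hs Ht; destruct (Hin s t Hs Ht).
    eapply Rle_trans; [apply H2; lra|]; simpl.
    apply Rmult_le_compat_l; [lra|]; apply Rmax_lub; lra. }
  unfold boundary_integral.
  assert (XQ : ex_RInt (fun t => Q (x + h) t - Q x t) y (y + k)).
  { apply ex_RInt_minus_of_continuous; [lra| |]; intros t Ht; apply CQ; lra. }
  assert (XP : ex_RInt (fun s => P s (y + k) - P s y) x (x + h)).
  { apply ex_RInt_minus_of_continuous; [lra| |]; intros t Ht; apply CP; lra. }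
  assert (IQ : Rabs (RInt (fun t => Q (x + h) t - Q x t - c * h) y (y + k)) <= k * (2 * e * (h + k))).
  { replace k with (y + k - y) at 2 by ring. apply abs_RInt_le_const; [lra| |].
    - apply (@ex_RInt_minus R_NormedModule _ (fun _ => c * h)); [exact XQ|apply ex_RInt_const].
    - intros t Ht.
      assert (A1 := EQ (x + h) t ltac:(lra) Ht). assert (A2 := EQ x t ltac:(lra) Ht).
      apply Rabs_le_between in A1; apply Rabs_le_between in A2; apply Rabs_le; lra. }
  assert (IP : Rabs (RInt (fun s => P s (y + k) - P s y - c * k) x (x + h)) <= h * (2 * e * (h + k))).
  { replace h with (x + h - x) at 2 by ring. apply abs_RInt_le_const; [lra| |].
    - apply (@ex_RInt_minus R_NormedModule _ (fun _ => c * k)); [exact XP|apply ex_RInt_const].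
    - intros s Hs.
      assert (A1 := EP s (y + k) Hs ltac:(lra)). assert (A2 := EP s y Hs ltac:(lra)).
      apply Rabs_le_between in A1; apply Rabs_le_between in A2; apply Rabs_le; lra. }
  rewrite (RInt_minus_R _ (fun _ => c * h)) in IQ; [|exact XQ|apply ex_RInt_const].
  rewrite (RInt_minus_R _ (fun _ => c * k)) in IP; [|exact XP|apply ex_RInt_const].
  rewrite RInt_const in IQ; rewrite RInt_const in IP.
  unfold scal in IQ, IP; simpl in IQ, IP; unfold mult in IQ, IP; simpl in IQ, IP.
  set (A := RInt (fun t => Q (x + h) t - Q x t) y (y + k)) in *.
  set (B := RInt (fun s => P s (y + k) - P s y) x (x + h)) in *.
  apply Rabs_le_between in IQ; apply Rabs_le_between in IP; apply Rabs_le.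
  replace eps with (2 * e) by (unfold e; field).
  split; nra.
Qed.

(** Goursat's theorem.  The bound [eps * (h + k) ^ 2] of a small cell is the sum of
    the bounds of its quarters, so it passes from small cells to the rectangle,
    and [eps] is arbitrary.  Pointwise differentiability is enough because each
    point only has to control the cells that contain it. *)
Lemma goursat_rectangle (P Q : R -> R -> R) (x0 y0 a b : R) :
  0 <= a -> 0 <= b ->
  (forall u v, x0 <= u <= x0 + a -> y0 <= v <= y0 + b ->
     exists px c qy, differentiable_pt_lim P u v px c /\ differentiable_pt_lim Q u v c qy) ->
  boundary_integral P Q x0 (x0 + a) y0 (y0 + b) = 0.
Proof.
  intros Ha Hb HD.
  assert (CP : forall u v, x0 <= u <= x0 + a -> y0 <= v <= y0 + b ->
    continuous (fun t => P t v) u).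
  { intros u v Hu Hv; destruct (HD u v Hu Hv) as [px [c [qy [H1 H2]]]].
    exact (differentiable_pt_lim_continuous_1 _ _ _ _ _ H1). }
  assert (CQ : forall u v, x0 <= u <= x0 + a -> y0 <= v <= y0 + b ->
    continuous (fun t => Q u t) v).
  { intros u v Hu Hv; destruct (HD u v Hu Hv) as [px [c [qy [H1 H2]]]].
    exact (differentiable_pt_lim_continuous_2 _ _ _ _ _ H2). }
  assert (Hpos : forall c n, 0 <= c -> 0 <= c / 2 ^ n).
  { intros c n Hc; apply Rmult_le_pos; [lra|]. left; apply Rinv_0_lt_compat, pow_lt; lra. }
  assert (Main : forall eps, 0 < eps ->
    Rabs (boundary_integral P Q x0 (x0 + a) y0 (y0 + b)) <= eps * (a + b) ^ 2).
  { intros eps He.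
    pose (T := fun n x y => Rabs (boundary_integral P Q x (x + a / 2 ^ n) y (y + b / 2 ^ n))
                 <= eps * (a / 2 ^ n + b / 2 ^ n) ^ 2).
    assert (HT : T 0%nat x0 y0).
    { apply dyadic_bisection with (a := a) (b := b); try assumption; unfold T.
      - intros n x y Hx1 Hx2 Hy1 Hy2 T1 T2 T3 T4.
        assert (Hh : forall c, c / 2 ^ n = c / 2 ^ (S n) + c / 2 ^ (S n)).
        { intros c; simpl; field; apply pow_nonzero; lra. }
        assert (Pa := Hpos a (S n) Ha). assert (Pb := Hpos b (S n) Hb).
        rewrite (Hh a) in Hx2 |- *. rewrite (Hh b) in Hy2 |- *.
        set (h := a / 2 ^ S n) in *. set (k := b / 2 ^ S n) in *.
        rewrite (boundary_integral_split P Q x (x + h) (x + (h + h)) y (y + k) (y + (k + k)));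
          [|lra|lra|intros; apply CP; lra|intros; apply CQ; lra].
        rewrite (Rplus_assoc x h h) in T2, T4. rewrite (Rplus_assoc y k k) in T3, T4.
        apply Rabs_le_between in T1, T2, T3, T4. apply Rabs_le.
        replace ((h + h + (k + k)) ^ 2) with (4 * (h + k) ^ 2) by ring. lra.
      - intros u v Hu Hv.
        destruct (HD u v Hu Hv) as [px [c [qy [D1 D2]]]].
        destruct (boundary_integral_small_cell P Q u v px c qy eps He D1 D2) as [d [Hd Hcell]].
        destruct (pow_lt_1_zero (1/2) ltac:(rewrite Rabs_pos_eq; lra) (d / (a + b + 1)))
          as [N HN].
        { apply Rdiv_lt_0_compat; lra. }
        exists N. intros n x y Hn Hx1 Hx2 Hy1 Hy2 Hxu Hyv.
        specialize (HN n Hn).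
        assert (Hhalf : (1 / 2) ^ n = / 2 ^ n).
        { unfold Rdiv; rewrite Rmult_1_l, pow_inv; reflexivity. }
        assert (H2n : 0 < / 2 ^ n) by (apply Rinv_0_lt_compat, pow_lt; lra).
        rewrite Hhalf, Rabs_pos_eq in HN by lra.
        assert (Hab : (a + b + 1) * / 2 ^ n < d).
        { apply Rmult_lt_compat_r with (r := a + b + 1) in HN; [|lra].
          replace (d / (a + b + 1) * (a + b + 1)) with d in HN by (field; lra). lra. }
        assert (Pa := Hpos a n Ha). assert (Pb := Hpos b n Hb).
        assert (La : a / 2 ^ n < d) by (unfold Rdiv; nra).
        assert (Lb : b / 2 ^ n < d) by (unfold Rdiv; nra).
        apply Hcell; [lra|lra|assumption|assumption| |].
        + intros; apply CP; lra.
        + intros; apply CQ; lra. }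
    unfold T in HT; simpl in HT. unfold Rdiv in HT. rewrite Rinv_1, !Rmult_1_r in HT.
    simpl; rewrite Rmult_1_r. exact HT. }
  apply cond_eq. intros eps He. rewrite Rminus_0_r.
  assert (H := fun Hq => Main (eps / (2 * ((a + b) ^ 2 + 1))) Hq).
  assert (Hsq : 0 <= (a + b) ^ 2) by apply pow2_ge_0.
  assert (Hq : 0 < eps / (2 * ((a + b) ^ 2 + 1))) by (apply Rdiv_lt_0_compat; lra).
  eapply Rle_lt_trans; [apply (H Hq)|].
  replace eps with (eps / (2 * ((a + b) ^ 2 + 1)) * (2 * ((a + b) ^ 2 + 1))) at 2 by (field; lra).
  apply Rmult_lt_compat_l; lra.
Qed.

(** * Means over circles do not depend on the radius *)

Lemma differentiable_pt_lim_lin (x y p q : R) :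
  differentiable_pt_lim (fun u v => p * u + q * v) x y p q.
Proof.
  intros eps; exists (mkposreal 1 Rlt_0_1); intros u v _ _.
  replace (p * u + q * v - (p * x + q * y) - (p * (u - x) + q * (v - y))) with 0 by ring.
  rewrite Rabs_R0. apply Rmult_le_pos; [left; apply cond_pos|].
  eapply Rle_trans; [apply Rabs_pos|apply Rmax_l].
Qed.

Lemma differentiable_pt_lim_Rmult (x y : R) :
  differentiable_pt_lim (fun u v => u * v) x y y x.
Proof.
  intros eps; exists eps; intros u v Hu Hv.
  replace (u * v - x * y - (y * (u - x) + x * (v - y))) with ((u - x) * (v - y)) by ring.
  rewrite Rabs_mult. assert (H := Rmax_r (Rabs (u - x)) (Rabs (v - y))).
  assert (H1 := Rabs_pos (u - x)). assert (H2 := Rabs_pos (v - y)). nra.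
Qed.

Lemma differentiable_pt_lim_lincomb (f g : R -> R -> R) (p q x y fx fy gx gy : R) :
  differentiable_pt_lim f x y fx fy -> differentiable_pt_lim g x y gx gy ->
  differentiable_pt_lim (fun u v => p * f u v + q * g u v) x y (p * fx + q * gx) (p * fy + q * gy).
Proof.
  intros Hf Hg. exact (differentiable_pt_lim_comp (fun a b => p * a + q * b) f g x y
    p q fx fy gx gy (differentiable_pt_lim_lin _ _ _ _) Hf Hg).
Qed.

Lemma differentiable_pt_lim_mult (f g : R -> R -> R) (x y fx fy gx gy : R) :
  differentiable_pt_lim f x y fx fy -> differentiable_pt_lim g x y gx gy ->
  differentiable_pt_lim (fun u v => f u v * g u v) x y
    (g x y * fx + f x y * gx) (g x y * fy + f x y * gy).
Proof.
  intros Hf Hg. exact (differentiable_pt_lim_comp (fun a b => a * b) f g x y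
    _ _ fx fy gx gy (differentiable_pt_lim_Rmult _ _) Hf Hg).
Qed.

Lemma differentiable_pt_lim_proj2 (f : R -> R) (x y l : R) :
  derivable_pt_lim f y l -> differentiable_pt_lim (fun _ v => f v) x y 0 l.
Proof.
  intros Hf.
  assert (Hv := differentiable_pt_lim_lin x y 0 1).
  assert (Hf' := differentiable_pt_lim_proj1_0 f (0 * x + 1 * y) (0 * x + 1 * y) l).
  replace (0 * x + 1 * y) with y in Hf' at 1 by ring.
  assert (H := differentiable_pt_lim_comp (fun a _ => f a) (fun u v => 0 * u + 1 * v)
    (fun u v => 0 * u + 1 * v) x y l 0 0 1 0 1 (Hf' Hf) Hv Hv).
  replace (l * 0 + 0 * 0) with 0 in H by ring. replace (l * 1 + 0 * 1) with l in H by ring.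
  apply differentiable_pt_lim_ext with (2 := H).
  exists (mkposreal 1 Rlt_0_1); intros u v _ _. f_equal; ring.
Qed.

(** Holomorphy at a point of a function of [x + i y] given as a function of the
    two real coordinates: Frechet differentiability and the Cauchy-Riemann
    equations. *)
Definition cauchy_riemann (H : R -> R -> C) (x y : R) : Prop :=
  exists p q : R,
    differentiable_pt_lim (fun u v => Re (H u v)) x y p (- q) /\
    differentiable_pt_lim (fun u v => Im (H u v)) x y q p.

Lemma cauchy_riemann_is_derive (f : C -> C) (x y : R) (l : C) :
  @is_derive C_AbsRing C_NormedModule f (x, y) l ->
  cauchy_riemann (fun u v => f (u, v)) x y.
Proof.
  intros Hf. exists (Re l), (Im l).
  assert (Hs : sqrt 2 < 2).
  { rewrite <- (sqrt_square 2) at 2 by lra. apply sqrt_lt_1; lra. }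
  assert (Hs0 := sqrt_pos 2).
  assert (Key : forall eps : posreal, locally_2d (fun u v =>
    Cmod (f (u, v) - f (x, y) - l * ((u, v) - (x, y))) <= eps * Rmax (Rabs (u - x)) (Rabs (v - y))) x y).
  { intros eps.
    destruct (is_derive_C_bound f (x, y) l Hf (eps / 2)) as [d [Hd Hb]].
    { apply Rdiv_lt_0_compat; [apply cond_pos|lra]. }
    assert (Hd2 : 0 < d / 2) by lra.
    exists (mkposreal (d / 2) Hd2); simpl; intros u v Hu Hv.
    assert (Hm : Cmod ((u, v) - (x, y)) <= 2 * Rmax (Rabs (u - x)) (Rabs (v - y))).
    { eapply Rle_trans; [apply Cmod_2Rmax|]. simpl.
      apply Rmult_le_compat_r; [|lra].
      eapply Rle_trans; [apply Rabs_pos|apply Rmax_l]. }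
    eapply Rle_trans; [apply Hb|].
    - assert (Rmax (Rabs (u - x)) (Rabs (v - y)) < d / 2) by (apply Rmax_lub_lt; assumption). lra.
    - assert (He := cond_pos eps).
      apply Rle_trans with (eps / 2 * (2 * Rmax (Rabs (u - x)) (Rabs (v - y)))); [|lra].
      apply Rmult_le_compat_l; lra. }
  split; intros eps; destruct (Key eps) as [d Hd]; exists d; intros u v Hu Hv;
    (eapply Rle_trans; [|apply (Hd u v Hu Hv)]).
  - eapply Rle_trans; [|apply re_le_Cmod].
    right; f_equal. destruct l; unfold Re, Im; simpl; ring.
  - eapply Rle_trans; [|apply im_le_Cmod].
    right; f_equal. destruct l; unfold Re, Im; simpl; ring.
Qed.

Lemma cauchy_riemann_comp (F G : R -> R -> C) (x y : R) :
  cauchy_riemann F (Re (G x y)) (Im (G x y)) -> cauchy_riemann G x y ->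
  cauchy_riemann (fun u v => F (Re (G u v)) (Im (G u v))) x y.
Proof.
  intros [p [q [H1 H2]]] [p' [q' [H3 H4]]].
  exists (p * p' - q * q'), (q * p' + p * q'). split.
  - replace (p * p' - q * q') with (p * p' + - q * q') by ring.
    replace (- (q * p' + p * q')) with (p * - q' + - q * p') by ring.
    exact (differentiable_pt_lim_comp _ _ _ _ _ _ _ _ _ _ _ H1 H3 H4).
  - replace (p * p' - q * q') with (q * - q' + p * p') by ring.
    exact (differentiable_pt_lim_comp _ _ _ _ _ _ _ _ _ _ _ H2 H3 H4).
Qed.

Lemma cauchy_riemann_mult (F G : R -> R -> C) (x y : R) :
  cauchy_riemann F x y -> cauchy_riemann G x y ->
  cauchy_riemann (fun u v => F u v * G u v)%C x y.
Proof.
  intros [p [q [H1 H2]]] [p' [q' [H3 H4]]].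
  assert (D1 := differentiable_pt_lim_lincomb _ _ 1 (-1) _ _ _ _ _ _
    (differentiable_pt_lim_mult _ _ _ _ _ _ _ _ H1 H3)
    (differentiable_pt_lim_mult _ _ _ _ _ _ _ _ H2 H4)).
  assert (D2 := differentiable_pt_lim_lincomb _ _ 1 1 _ _ _ _ _ _
    (differentiable_pt_lim_mult _ _ _ _ _ _ _ _ H1 H4)
    (differentiable_pt_lim_mult _ _ _ _ _ _ _ _ H2 H3)).
  cbv beta in D1, D2.
  set (a := Re (F x y)) in *; set (b := Im (F x y)) in *.
  set (a' := Re (G x y)) in *; set (b' := Im (G x y)) in *.
  exists (a' * p + a * p' - b' * q - b * q'), (b' * p + a * q' + a' * q + b * p').
  split.
  - eapply differentiable_pt_lim_ext.
    2: { match type of D1 with differentiable_pt_lim _ _ _ ?l1 ?l2 =>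
           replace (a' * p + a * p' - b' * q - b * q') with l1 by ring;
           replace (- (b' * p + a * q' + a' * q + b * p')) with l2 by ring end.
         exact D1. }
    exists (mkposreal 1 Rlt_0_1); intros u v _ _; unfold Re, Im; simpl; ring.
  - eapply differentiable_pt_lim_ext.
    2: { match type of D2 with differentiable_pt_lim _ _ _ ?l1 ?l2 =>
           replace (a' * p + a * p' - b' * q - b * q') with l2 by ring;
           replace (b' * p + a * q' + a' * q + b * p') with l1 by ring end.
         exact D2. }
    exists (mkposreal 1 Rlt_0_1); intros u v _ _; unfold Re, Im; simpl; ring.
Qed.

(** [cis n t] is [exp (i n t)], and [cexp n x y] is [exp (n (x + i y))]. *)
Definition cis (n t : R) : C := (cos (n * t), sin (n * t)).
Definition cexp (n x y : R) : C := (RtoC (exp (n * x)) * cis n y)%C.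

Lemma cauchy_riemann_cexp (n x y : R) : cauchy_riemann (cexp n) x y.
Proof.
  assert (De : derivable_pt_lim (fun u => exp (n * u)) x (n * exp (n * x))).
  { apply is_derive_Reals. auto_derive; [trivial|ring]. }
  assert (Dc : derivable_pt_lim (fun v => cos (n * v)) y (- n * sin (n * y))).
  { apply is_derive_Reals. auto_derive; [trivial|ring]. }
  assert (Ds : derivable_pt_lim (fun v => sin (n * v)) y (n * cos (n * y))).
  { apply is_derive_Reals. auto_derive; [trivial|ring]. }
  assert (D1 := differentiable_pt_lim_mult _ _ _ _ _ _ _ _
    (differentiable_pt_lim_proj1_0 _ x y _ De) (differentiable_pt_lim_proj2 _ x y _ Dc)).
  assert (D2 := differentiable_pt_lim_mult _ _ _ _ _ _ _ _
    (differentiable_pt_lim_proj1_0 _ x y _ De) (differentiable_pt_lim_proj2 _ x y _ Ds)).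
  cbv beta in D1, D2.
  exists (n * exp (n * x) * cos (n * y)), (n * exp (n * x) * sin (n * y)).
  split.
  - eapply differentiable_pt_lim_ext.
    2: { match type of D1 with differentiable_pt_lim _ _ _ ?l1 ?l2 =>
           replace (n * exp (n * x) * cos (n * y)) with l1 by ring;
           replace (- (n * exp (n * x) * sin (n * y))) with l2 by ring end.
         exact D1. }
    exists (mkposreal 1 Rlt_0_1); intros u v _ _; unfold Re, Im; simpl; ring.
  - eapply differentiable_pt_lim_ext.
    2: { match type of D2 with differentiable_pt_lim _ _ _ ?l1 ?l2 =>
           replace (n * exp (n * x) * cos (n * y)) with l2 by ring;
           replace (n * exp (n * x) * sin (n * y)) with l1 by ring end.
         exact D2. }
    exists (mkposreal 1 Rlt_0_1); intros u v _ _; unfold Re, Im; simpl; ring.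
Qed.

Definition circle_mean (phi : R -> C) : C :=
  (RInt (fun t => Re (phi t)) 0 (2 * PI) / (2 * PI),
   RInt (fun t => Im (phi t)) 0 (2 * PI) / (2 * PI)).

(** In the coordinate [x + i y = log w], circles become vertical segments; for a
    function of period [2 pi i] the two horizontal sides of the rectangle
    between two such segments cancel, and Goursat says that the mean does not
    depend on the radius. *)
Lemma circle_mean_radius_independent (H : R -> R -> C) (x1 x2 : R) :
  (forall x y, x < 0 -> cauchy_riemann H x y) ->
  (forall x, H x (2 * PI) = H x 0) ->
  x1 <= x2 -> x2 < 0 -> circle_mean (H x2) = circle_mean (H x1).
Proof.
  intros HH Hper Hle Hlt.
  assert (HPI := PI_RGT_0).
  assert (Core : forall P Q : R -> R -> R,
    (forall x y, x < 0 -> exists px c qy,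
      differentiable_pt_lim P x y px c /\ differentiable_pt_lim Q x y c qy) ->
    (forall x, P x (2 * PI) = P x 0) ->
    RInt (Q x2) 0 (2 * PI) = RInt (Q x1) 0 (2 * PI)).
  { intros P Q HPQ HP.
    assert (G := goursat_rectangle P Q x1 0 (x2 - x1) (2 * PI) ltac:(lra) ltac:(lra)).
    replace (x1 + (x2 - x1)) with x2 in G by ring.
    rewrite Rplus_0_l in G.
    assert (G' : boundary_integral P Q x1 x2 0 (2 * PI) = 0).
    { apply G; intros u v Hu Hv; apply HPQ; lra. }
    unfold boundary_integral in G'.
    assert (HQ : forall x, x < 0 -> ex_RInt (Q x) 0 (2 * PI)).
    { intros x Hx; apply ex_RInt_of_continuous; [lra|]; intros t Ht.
      destruct (HPQ x t Hx) as [px [c [qy [_ D]]]].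
      exact (differentiable_pt_lim_continuous_2 _ _ _ _ _ D). }
    rewrite RInt_minus_R in G' by (apply HQ; lra).
    rewrite (RInt_ext (fun x => P x (2 * PI) - P x 0) (fun _ => 0)) in G'
      by (intros x _; rewrite HP; apply Rplus_opp_r).
    rewrite RInt_const in G'. unfold scal in G'; simpl in G'; unfold mult in G'; simpl in G'.
    lra. }
  (* [H (dx + i dy)] has real part [Re H dx - Im H dy] and imaginary part
     [Im H dx + Re H dy]; the Cauchy-Riemann equations make both closed. *)
  unfold circle_mean; f_equal; f_equal.
  - apply (Core (fun x y => Im (H x y)) (fun x y => Re (H x y))).
    + intros x y Hx; destruct (HH x y Hx) as [p [q [D1 D2]]]. exists q, p, (- q); auto.
    + intros x; rewrite Hper; reflexivity.
  - apply (Core (fun x y => - Re (H x y)) (fun x y => Im (H x y))).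
    + intros x y Hx; destruct (HH x y Hx) as [p [q [D1 D2]]]. exists (- p), q, p; split; [|assumption].
      assert (D := differentiable_pt_lim_lincomb _ _ (-1) 0 _ _ _ _ _ _ D1 D1).
      replace (-1 * p + 0 * p) with (- p) in D by ring.
      replace (-1 * - q + 0 * - q) with q in D by ring.
      eapply differentiable_pt_lim_ext with (2 := D).
      exists (mkposreal 1 Rlt_0_1); intros u v _ _; ring.
    + intros x; rewrite Hper; reflexivity.
Qed.

(** * Fourier coefficients and Bessel's inequality *)

(** Continuity of a complex function of a real variable, by components, so that
    the real integration theory applies directly. *)
Definition ccontinuous (phi : R -> C) (t : R) : Prop :=
  continuous (fun s => Re (phi s)) t /\ continuous (fun s => Im (phi s)) t.

Lemma continuous_R_iff (f : R -> R) (t : R) :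
  continuous f t <-> forall eps, 0 < eps -> exists d, 0 < d /\
    forall s, Rabs (s - t) < d -> Rabs (f s - f t) < eps.
Proof.
  split.
  - intros H eps He.
    destruct (H (fun y => Rabs (y - f t) < eps)) as [d Hd].
    + exists (mkposreal eps He); intros y Hy; exact Hy.
    + exists d; split; [apply cond_pos|exact Hd].
  - intros H P [eps HP]. destruct (H eps (cond_pos eps)) as [d [Hd K]].
    exists (mkposreal d Hd); intros s Hs; apply HP, K, Hs.
Qed.

Lemma ccontinuous_iff (phi : R -> C) (t : R) :
  ccontinuous phi t <-> forall eps, 0 < eps -> exists d, 0 < d /\
    forall s, Rabs (s - t) < d -> Cmod (phi s - phi t) < eps.
Proof.
  unfold ccontinuous; rewrite !continuous_R_iff; split.
  - intros [Hr Hi] eps He.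
    destruct (Hr (eps / 2)) as [d1 [P1 H1]]; [lra|].
    destruct (Hi (eps / 2)) as [d2 [P2 H2]]; [lra|].
    exists (Rmin d1 d2); split; [apply Rmin_glb_lt; lra|]. intros s Hs.
    assert (L1 := Rmin_l d1 d2); assert (L2 := Rmin_r d1 d2).
    specialize (H1 s ltac:(lra)); specialize (H2 s ltac:(lra)).
    eapply Rle_lt_trans; [apply Cmod_le_Re_Im|].
    change (Re (phi s - phi t)) with (Re (phi s) - Re (phi t)).
    change (Im (phi s - phi t)) with (Im (phi s) - Im (phi t)). lra.
  - intros H; split; intros eps He; destruct (H eps He) as [d [P K]]; exists d; split; trivial;
      intros s Hs; (eapply Rle_lt_trans; [|apply (K s Hs)]).
    + apply (re_le_Cmod (phi s - phi t)).
    + apply (im_le_Cmod (phi s - phi t)).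
Qed.

Lemma ccontinuous_const (c : C) (t : R) : ccontinuous (fun _ => c) t.
Proof. split; apply continuous_const. Qed.

Lemma ccontinuous_plus (f g : R -> C) (t : R) :
  ccontinuous f t -> ccontinuous g t -> ccontinuous (fun s => f s + g s)%C t.
Proof.
  intros [H1 H2] [H3 H4]; split;
    apply (@continuous_plus R_UniformSpace R_AbsRing R_NormedModule); assumption.
Qed.

Lemma ccontinuous_minus (f g : R -> C) (t : R) :
  ccontinuous f t -> ccontinuous g t -> ccontinuous (fun s => f s - g s)%C t.
Proof.
  intros [H1 H2] [H3 H4]; split;
    apply (@continuous_minus R_UniformSpace R_AbsRing R_NormedModule); assumption.
Qed.

Lemma ccontinuous_mult (f g : R -> C) (t : R) :
  ccontinuous f t -> ccontinuous g t -> ccontinuous (fun s => f s * g s)%C t.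
Proof.
  intros [H1 H2] [H3 H4]; split.
  - apply (@continuous_minus R_UniformSpace R_AbsRing R_NormedModule);
      apply (@continuous_mult R_UniformSpace R_AbsRing); assumption.
  - apply (@continuous_plus R_UniformSpace R_AbsRing R_NormedModule);
      apply (@continuous_mult R_UniformSpace R_AbsRing); assumption.
Qed.

Lemma ccontinuous_conj (f : R -> C) (t : R) :
  ccontinuous f t -> ccontinuous (fun s => Cconj (f s)) t.
Proof.
  intros [H1 H2]; split; [exact H1|].
  apply (@continuous_opp R_UniformSpace R_AbsRing R_NormedModule); exact H2.
Qed.

Lemma ccontinuous_cis (n t : R) : ccontinuous (cis n) t.
Proof.
  split; apply (@ex_derive_continuous R_AbsRing R_NormedModule); unfold cis; simpl; auto_derive; trivial.
Qed.

(* The rules are selected on the syntax of the function, since unification would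
   unfold the complex operations into their components. *)
Ltac ccont := repeat match goal with
  | H : forall t, ccontinuous ?f t |- ccontinuous ?f _ => apply H
  | H : forall t, ccontinuous ?f t |- ccontinuous (fun s => ?f s) _ => apply H
  | |- ccontinuous (cis ?n) _ => apply ccontinuous_cis
  | |- ccontinuous (fun s => cis ?n s) _ => apply ccontinuous_cis
  | |- ccontinuous (fun s => ?c) _ => apply ccontinuous_const
  | |- ccontinuous (fun s => Cplus _ _) _ => apply ccontinuous_plus
  | |- ccontinuous (fun s => Cminus _ _) _ => apply ccontinuous_minus
  | |- ccontinuous (fun s => Cmult _ _) _ => apply ccontinuous_mult
  | |- ccontinuous (fun s => Cconj _) _ => apply ccontinuous_conj
  end.

Lemma ccontinuous_ex_RInt (f : R -> C) (a b : R) :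
  (forall t, ccontinuous f t) ->
  ex_RInt (fun t => Re (f t)) a b /\ ex_RInt (fun t => Im (f t)) a b.
Proof.
  intros H; split; apply (@ex_RInt_continuous R_CompleteNormedModule); intros t _; apply H.
Qed.

Lemma RInt_lincomb (f g : R -> R) (p q a b : R) :
  ex_RInt f a b -> ex_RInt g a b ->
  RInt (fun t => p * f t + q * g t) a b = p * RInt f a b + q * RInt g a b.
Proof.
  intros Hf Hg.
  assert (Ip := is_RInt_scal f a b p _ (RInt_correct _ _ _ Hf)).
  assert (Iq := is_RInt_scal g a b q _ (RInt_correct _ _ _ Hg)).
  exact (is_RInt_unique _ _ _ _ (is_RInt_plus _ _ _ _ _ _ Ip Iq)).
Qed.

Lemma RInt_ext_R (f g : R -> R) (a b : R) : (forall t, f t = g t) -> RInt f a b = RInt g a b.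
Proof. intros H; apply RInt_ext; intros; apply H. Qed.

Lemma circle_mean_ext (f g : R -> C) :
  (forall t, f t = g t) -> circle_mean f = circle_mean g.
Proof.
  intros H; unfold circle_mean.
  rewrite (RInt_ext_R (fun t => Re (f t)) (fun t => Re (g t))) by (intros; now rewrite H).
  rewrite (RInt_ext_R (fun t => Im (f t)) (fun t => Im (g t))) by (intros; now rewrite H).
  reflexivity.
Qed.

Lemma circle_mean_plus (f g : R -> C) :
  (forall t, ccontinuous f t) -> (forall t, ccontinuous g t) ->
  circle_mean (fun t => f t + g t)%C = (circle_mean f + circle_mean g)%C.
Proof.
  intros Hf Hg.
  destruct (ccontinuous_ex_RInt f 0 (2 * PI) Hf) as [F1 F2].
  destruct (ccontinuous_ex_RInt g 0 (2 * PI) Hg) as [G1 G2].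
  assert (HPI := PI_RGT_0). unfold circle_mean, Cplus; simpl; f_equal.
  - rewrite (RInt_ext_R _ (fun t => 1 * Re (f t) + 1 * Re (g t))) by (intros; unfold Re; ring).
    rewrite RInt_lincomb by assumption. field; lra.
  - rewrite (RInt_ext_R _ (fun t => 1 * Im (f t) + 1 * Im (g t))) by (intros; unfold Im; ring).
    rewrite RInt_lincomb by assumption. field; lra.
Qed.

Lemma circle_mean_scal (c : C) (f : R -> C) :
  (forall t, ccontinuous f t) ->
  circle_mean (fun t => c * f t)%C = (c * circle_mean f)%C.
Proof.
  intros Hf.
  destruct (ccontinuous_ex_RInt f 0 (2 * PI) Hf) as [F1 F2].
  assert (HPI := PI_RGT_0). destruct c as [p q]. unfold circle_mean, Cmult; simpl; f_equal.
  - rewrite (RInt_ext_R _ (fun t => p * Re (f t) + - q * Im (f t))) by (intros; unfold Re, Im; ring).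
    rewrite RInt_lincomb by assumption. field; lra.
  - rewrite (RInt_ext_R _ (fun t => p * Im (f t) + q * Re (f t))) by (intros; unfold Re, Im; ring).
    rewrite RInt_lincomb by assumption. field; lra.
Qed.

Lemma circle_mean_minus (f g : R -> C) :
  (forall t, ccontinuous f t) -> (forall t, ccontinuous g t) ->
  circle_mean (fun t => f t - g t)%C = (circle_mean f - circle_mean g)%C.
Proof.
  intros Hf Hg.
  rewrite (circle_mean_ext _ (fun t => f t + RtoC (-1) * g t)%C).
  - rewrite circle_mean_plus, circle_mean_scal by (intros; ccont).
    replace (RtoC (-1)) with (- RtoC 1)%C by (rewrite <- RtoC_opp; reflexivity). ring.
  - intros t; replace (RtoC (-1)) with (- RtoC 1)%C by (rewrite <- RtoC_opp; reflexivity). ring.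
Qed.

Lemma circle_mean_const (c : C) : circle_mean (fun _ => c) = c.
Proof.
  assert (HPI := PI_RGT_0). destruct c as [p q]; unfold circle_mean; simpl.
  rewrite !RInt_const; unfold scal; simpl; unfold mult; simpl. f_equal; field; lra.
Qed.

Lemma circle_mean_conj (f : R -> C) :
  (forall t, ccontinuous f t) ->
  circle_mean (fun t => Cconj (f t)) = Cconj (circle_mean f).
Proof.
  intros Hf.
  destruct (ccontinuous_ex_RInt f 0 (2 * PI) Hf) as [F1 F2].
  assert (HPI := PI_RGT_0). unfold circle_mean, Cconj; simpl; f_equal.
  rewrite (RInt_ext_R _ (fun t => -1 * Im (f t) + 0 * Im (f t))) by (intros; unfold Im; simpl; ring).
  rewrite RInt_lincomb by assumption. unfold Im; field; lra.
Qed.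

Lemma circle_mean_Re_le (f g : R -> C) :
  (forall t, ccontinuous f t) -> (forall t, ccontinuous g t) ->
  (forall t, Re (f t) <= Re (g t)) -> Re (circle_mean f) <= Re (circle_mean g).
Proof.
  intros Hf Hg H. assert (HPI := PI_RGT_0). unfold circle_mean; simpl.
  apply Rmult_le_compat_r; [left; apply Rinv_0_lt_compat; lra|].
  apply RInt_le; [lra| | |intros; apply H].
  - exact (proj1 (ccontinuous_ex_RInt f _ _ Hf)).
  - exact (proj1 (ccontinuous_ex_RInt g _ _ Hg)).
Qed.

Lemma Cconj_mult_Cmod (c : C) : (Cconj c * c)%C = RtoC (Cmod c ^ 2).
Proof. rewrite Cmult_comm, <- Cmod2_conj; reflexivity. Qed.

(** Rotating the mean onto the positive axis reduces the bound to a comparison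
    of real integrals. *)
Lemma circle_mean_bound (f : R -> C) (B : R) :
  (forall t, ccontinuous f t) -> (forall t, Cmod (f t) <= B) -> Cmod (circle_mean f) <= B.
Proof.
  intros Hf HB. set (m := circle_mean f).
  assert (H : Cmod m ^ 2 <= Cmod m * B).
  { assert (E : circle_mean (fun t => Cconj m * f t)%C = RtoC (Cmod m ^ 2)).
    { rewrite circle_mean_scal by assumption. apply Cconj_mult_Cmod. }
    change (Cmod m ^ 2) with (Re (RtoC (Cmod m ^ 2))). rewrite <- E.
    replace (Cmod m * B) with (Re (circle_mean (fun _ => RtoC (Cmod m * B))))
      by (rewrite circle_mean_const; reflexivity).
    apply circle_mean_Re_le; [intros; ccont..|]. intros t.
    eapply Rle_trans; [apply Rle_abs|]. eapply Rle_trans; [apply re_le_Cmod|].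
    rewrite Cmod_mult, Cmod_conj; simpl. apply Rmult_le_compat_l; [apply Cmod_ge_0|apply HB]. }
  assert (H0 := Cmod_ge_0 m).
  destruct (Req_dec (Cmod m) 0) as [Z|NZ].
  - rewrite Z. eapply Rle_trans; [apply (Cmod_ge_0 (f 0))|apply HB].
  - apply Rmult_le_reg_l with (Cmod m); [lra|]. simpl in H; lra.
Qed.

Lemma cis_plus (m n t : R) : (cis m t * cis n t)%C = cis (m + n) t.
Proof.
  unfold cis, Cmult; simpl.
  rewrite (Rmult_plus_distr_r m n t), cos_plus, sin_plus. f_equal; ring.
Qed.

Lemma cis_0 (t : R) : cis 0 t = RtoC 1.
Proof. unfold cis; rewrite Rmult_0_l, cos_0, sin_0; reflexivity. Qed.

Lemma cis_conj (n t : R) : Cconj (cis n t) = cis (- n) t.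
Proof.
  unfold cis, Cconj; simpl.
  replace (- n * t) with (- (n * t)) by ring. rewrite cos_neg, sin_neg; reflexivity.
Qed.

Lemma Cmod_cis (n t : R) : Cmod (cis n t) = 1.
Proof.
  unfold Cmod, cis; simpl. assert (H := sin2_cos2 (n * t)); unfold Rsqr in H.
  rewrite !Rmult_1_r, Rplus_comm, H. apply sqrt_1.
Qed.

Lemma cis_nat_period (j : nat) : cis (INR j) (2 * PI) = RtoC 1.
Proof.
  unfold cis.
  replace (INR j * (2 * PI)) with (0 + 2 * INR j * PI) by ring.
  rewrite cos_period, sin_period, cos_0, sin_0; reflexivity.
Qed.

Lemma cis_neg_nat_period (j : nat) : cis (- INR j) (2 * PI) = RtoC 1.
Proof. rewrite <- cis_conj, cis_nat_period. unfold Cconj; simpl; rewrite Ropp_0; reflexivity. Qed.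

Lemma circle_mean_cis (n : R) : n <> 0 -> cis n (2 * PI) = RtoC 1 -> circle_mean (cis n) = RtoC 0.
Proof.
  intros Hn Hper. injection Hper as Hc Hs.
  assert (HPI := PI_RGT_0).
  assert (I1 : is_RInt (fun t => cos (n * t)) 0 (2 * PI) (sin (n * (2 * PI)) / n - sin (n * 0) / n)).
  { apply (is_RInt_derive (fun t => sin (n * t) / n)).
    - intros t _. auto_derive; [trivial|field; assumption].
    - intros t _. apply (@ex_derive_continuous R_AbsRing R_NormedModule). auto_derive; trivial. }
  assert (I2 : is_RInt (fun t => sin (n * t)) 0 (2 * PI) (- cos (n * (2 * PI)) / n - - cos (n * 0) / n)).
  { apply (is_RInt_derive (fun t => - cos (n * t) / n)).
    - intros t _. auto_derive; [trivial|field; assumption].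
    - intros t _. apply (@ex_derive_continuous R_AbsRing R_NormedModule). auto_derive; trivial. }
  apply (@is_RInt_unique R_CompleteNormedModule) in I1.
  apply (@is_RInt_unique R_CompleteNormedModule) in I2.
  unfold circle_mean, cis; simpl. rewrite I1, I2, Hc, Hs, Rmult_0_r, sin_0, cos_0.
  unfold RtoC; f_equal; field; lra.
Qed.

(** Only the indices [j >= 0] occur: a coefficient of negative index is the
    conjugate of one of the conjugate function. *)
Definition fourier (f : R -> C) (j : nat) : C := circle_mean (fun t => f t * cis (- INR j) t)%C.

(** Bessel: subtracting the harmonics one at a time, the remainder keeps the
    later coefficients and its mean square decreases by the square of the
    removed one. *)
Lemma bessel_inequality (f : R -> C) (N : nat) :
  (forall t, ccontinuous f t) ->
  sum_n (fun j => Cmod (fourier f j) ^ 2) N <= Re (circle_mean (fun t => f t * Cconj (f t))%C).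
Proof.
  intros Hf.
  pose (c := fourier f).
  assert (Key : forall n, exists g : R -> C, (forall t, ccontinuous g t) /\
    (forall j, (n < j)%nat -> fourier g j = c j) /\
    Re (circle_mean (fun t => g t * Cconj (g t))%C) =
      Re (circle_mean (fun t => f t * Cconj (f t))%C) - sum_n (fun j => Cmod (c j) ^ 2) n).
  { assert (Step : forall (g : R -> C) n, (forall t, ccontinuous g t) ->
      (forall j, (n <= j)%nat -> fourier g j = c j) -> exists g' : R -> C,
      (forall t, ccontinuous g' t) /\ (forall j, (n < j)%nat -> fourier g' j = c j) /\
      Re (circle_mean (fun t => g' t * Cconj (g' t))%C) =
        Re (circle_mean (fun t => g t * Cconj (g t))%C) - Cmod (c n) ^ 2).
    { intros g n Hg Hc. exists (fun t => g t - c n * cis (INR n) t)%C.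
      split; [intros; ccont|split].
      - intros j Hj. unfold fourier.
        rewrite (circle_mean_ext _ (fun t => g t * cis (- INR j) t - c n * cis (INR n + - INR j) t)%C)
          by (intros; rewrite <- cis_plus; ring).
        rewrite circle_mean_minus, circle_mean_scal by (intros; ccont).
        rewrite circle_mean_cis.
        + fold (fourier g j). rewrite Hc by lia. ring.
        + apply lt_INR in Hj. lra.
        + rewrite <- cis_plus, cis_nat_period, cis_neg_nat_period. ring.
      - rewrite (circle_mean_ext _ (fun t =>
          (g t * Cconj (g t) + c n * Cconj (c n)) -
          (c n * Cconj (g t * cis (- INR n) t) + Cconj (c n) * (g t * cis (- INR n) t)))%C).
        + rewrite circle_mean_minus, !circle_mean_plus, !circle_mean_scal, circle_mean_const,
            (circle_mean_conj (fun t => g t * cis (- INR n) t)%C) by (intros; ccont).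
          fold (fourier g n). rewrite Hc by lia.
          replace (circle_mean (fun t => g t * Cconj (g t)) + c n * Cconj (c n)
            - (c n * Cconj (c n) + Cconj (c n) * c n))%C
            with (circle_mean (fun t => g t * Cconj (g t)) - Cconj (c n) * c n)%C by ring.
          rewrite Cconj_mult_Cmod. reflexivity.
        + intros t. rewrite Cminus_conj, !Cmult_conj, !cis_conj, Ropp_involutive.
          assert (E : (cis (INR n) t * cis (- INR n) t)%C = RtoC 1)
            by (rewrite cis_plus, Rplus_opp_r, cis_0; reflexivity).
          replace (c n * Cconj (c n))%C with (c n * Cconj (c n) * (cis (INR n) t * cis (- INR n) t))%C
            by (rewrite E; ring). ring. }
    induction n as [|n [g [Hg [Hc HE]]]].
    - destruct (Step f 0%nat Hf ltac:(reflexivity)) as [g [H1 [H2 H3]]].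
      exists g; repeat split; try apply H1; trivial. rewrite sum_O; exact H3.
    - destruct (Step g (S n) Hg) as [g' [H1 [H2 H3]]]; [intros; apply Hc; lia|].
      exists g'; repeat split; try apply H1; trivial. rewrite sum_Sn, H3, HE.
      unfold plus; simpl. ring. }
  destruct (Key N) as [g [Hg [_ HE]]].
  assert (P : 0 <= Re (circle_mean (fun t => g t * Cconj (g t))%C)).
  { replace 0 with (Re (circle_mean (fun _ => RtoC 0))) by (rewrite circle_mean_const; reflexivity).
    apply circle_mean_Re_le; [intros; ccont..|]. intros t.
    rewrite <- Cmod2_conj. simpl. rewrite Rmult_1_r.
    apply Rmult_le_pos; apply Cmod_ge_0. }
  unfold c in HE. lra.
Qed.

Lemma fourier_lim_0 (f : R -> C) :
  (forall t, ccontinuous f t) -> is_lim_seq (fun j => Cmod (fourier f j)) 0.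
Proof.
  intros Hf.
  assert (Hs : ex_series (fun j => Cmod (fourier f j) ^ 2)).
  { apply ex_series_nonneg_bounded with (Re (circle_mean (fun t => f t * Cconj (f t))%C)).
    - intros n; apply pow2_ge_0.
    - intros n; apply bessel_inequality, Hf. }
  apply ex_series_lim_0 in Hs.
  apply is_lim_seq_ext with (fun j => sqrt (Cmod (fourier f j) ^ 2)).
  - intros j; apply sqrt_pow2, Cmod_ge_0.
  - rewrite <- sqrt_0. apply is_lim_seq_continuous; [|exact Hs].
    apply continuity_pt_sqrt; lra.
Qed.

(** * Taylor expansion of bounded analytic functions *)

Lemma Cmod_cexp (n x t : R) : Cmod (cexp n x t) = exp (n * x).
Proof.
  unfold cexp. rewrite Cmod_mult, Cmod_cis, Cmod_R, Rabs_pos_eq by (left; apply exp_pos). ring.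
Qed.

Lemma disc_cexp (x t : R) : x < 0 -> disc (cexp 1 x t).
Proof.
  intros Hx. unfold disc. rewrite Cmod_cexp, Rmult_1_l, <- exp_0. apply exp_increasing; assumption.
Qed.

Lemma ccontinuous_comp (q : C -> C) (g : R -> C) (t : R) :
  (forall eps, 0 < eps -> exists d, 0 < d /\ forall w, Cmod (w - g t) < d ->
     Cmod (q w - q (g t)) < eps) ->
  ccontinuous g t -> ccontinuous (fun s => q (g s)) t.
Proof.
  rewrite !ccontinuous_iff. intros Hq Hg eps He.
  destruct (Hq eps He) as [d [Hd K]]. destruct (Hg d Hd) as [d' [Hd' K']].
  exists d'; split; [assumption|]. intros s Hs. apply K, K', Hs.
Qed.

Lemma is_derive_C_continuous (f : C -> C) (z l : C) :
  @is_derive C_AbsRing C_NormedModule f z l ->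
  forall eps, 0 < eps -> exists d, 0 < d /\ forall w, Cmod (w - z) < d ->
    Cmod (f w - f z) < eps.
Proof.
  intros H eps He.
  destruct (is_derive_C_bound f z l H 1 Rlt_0_1) as [d [Hd K]].
  assert (Hl := Cmod_ge_0 l).
  assert (Hq : 0 < eps / (Cmod l + 1)) by (apply Rdiv_lt_0_compat; lra).
  exists (Rmin d (eps / (Cmod l + 1))); split; [apply Rmin_glb_lt; assumption|].
  intros w Hw.
  assert (L1 := Rmin_l d (eps / (Cmod l + 1))). assert (L2 := Rmin_r d (eps / (Cmod l + 1))).
  specialize (K w ltac:(lra)).
  replace (f w - f z)%C with ((f w - f z - l * (w - z)) + l * (w - z))%C by ring.
  eapply Rle_lt_trans; [apply Cmod_triangle|]. rewrite Cmod_mult.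
  apply Rle_lt_trans with ((Cmod l + 1) * Cmod (w - z)); [lra|].
  apply Rlt_le_trans with ((Cmod l + 1) * (eps / (Cmod l + 1))); [|right; field; lra].
  apply Rmult_lt_compat_l; lra.
Qed.

(** At [z] the continuity is the differentiability of [f]; elsewhere it is read off
    [(w - z) (q w - q w0) = (f w - f w0) - (w - w0) q w0]. *)
Lemma difference_quotient_continuous (f : C -> C) (z : C) :
  analytic f -> disc z -> exists q : C -> C,
    (forall w, (f w - f z)%C = ((w - z) * q w)%C) /\
    (forall w0, disc w0 -> forall eps, 0 < eps -> exists d, 0 < d /\
       forall w, Cmod (w - w0) < d -> Cmod (q w - q w0) < eps).
Proof.
  intros Hf Hz. destruct (Hf z Hz) as [l Hl].
  pose (q := fun w => if excluded_middle_informative (w = z) then l else ((f w - f z) / (w - z))%C).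
  assert (Hpos : forall w, w <> z -> 0 < Cmod (w - z)).
  { intros w Hw. apply Cmod_gt_0. intros E; apply Hw.
    replace w with (w - z + z)%C by ring. rewrite E; ring. }
  assert (Hq : forall w, (f w - f z)%C = ((w - z) * q w)%C).
  { intros w; unfold q. destruct (excluded_middle_informative (w = z)) as [->|Hw]; [ring|].
    field. apply Cmod_gt_0, Hpos, Hw. }
  exists q; split; [exact Hq|]. intros w0 Hw0 eps He.
  destruct (excluded_middle_informative (w0 = z)) as [->|Ent].
  - destruct (is_derive_C_bound f z l Hl (eps / 2)) as [d [Hd K]]; [lra|].
    exists d; split; [assumption|]. intros w Hw.
    destruct (excluded_middle_informative (w = z)) as [->|Hwz].
    + replace (q z - q z)%C with (RtoC 0) by ring. rewrite Cmod_0; assumption.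
    + specialize (K w Hw). rewrite Hq in K.
      assert (Hqz : q z = l).
      { unfold q; destruct (excluded_middle_informative (z = z)); [reflexivity|contradiction]. }
      rewrite Hqz.
      replace ((w - z) * q w - l * (w - z))%C with ((q w - l) * (w - z))%C in K by ring.
      rewrite Cmod_mult in K. apply Rmult_le_reg_r in K; [lra|apply Hpos, Hwz].
  - assert (Hp := Hpos w0 Ent). set (m := Cmod (w0 - z)) in *.
    destruct (Hf w0 Hw0) as [l0 Hl0].
    assert (Hm2 : 0 < m / 4 * eps) by (apply Rmult_lt_0_compat; lra).
    destruct (is_derive_C_continuous f w0 l0 Hl0 _ Hm2) as [d [Hd K]].
    set (Q := Cmod (q w0)). assert (HQ : 0 <= Q) by apply Cmod_ge_0.
    assert (Hd2 : 0 < m / 4 * eps / (Q + 1)) by (apply Rdiv_lt_0_compat; lra).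
    set (d' := Rmin d (Rmin (m / 2) (m / 4 * eps / (Q + 1)))).
    exists d'. split; [repeat apply Rmin_glb_lt; lra|].
    intros w Hw.
    assert (L1 : d' <= d) by apply Rmin_l.
    assert (L2 : d' <= m / 2) by (eapply Rle_trans; [apply Rmin_r|apply Rmin_l]).
    assert (L3 : d' <= m / 4 * eps / (Q + 1)) by (eapply Rle_trans; [apply Rmin_r|apply Rmin_r]).
    assert (Hwm : m / 2 <= Cmod (w - z)).
    { assert (T := Cmod_triangle (w0 - w) (w - z)).
      replace (w0 - w + (w - z))%C with (w0 - z)%C in T by ring. fold m in T.
      rewrite Cmod_minus_sym in T. lra. }
    assert (E : ((w - z) * (q w - q w0))%C = ((f w - f w0) - (w - w0) * q w0)%C).
    { replace (f w - f w0)%C with ((f w - f z) - (f w0 - f z))%C by ring.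
      rewrite !Hq. ring. }
    apply (f_equal Cmod) in E. rewrite Cmod_mult in E.
    assert (T := Cmod_triangle (f w - f w0) (- ((w - w0) * q w0))).
    rewrite Cmod_opp, Cmod_mult in T. fold Q in T.
    replace (f w - f w0 + - ((w - w0) * q w0))%C with (f w - f w0 - (w - w0) * q w0)%C in T by ring.
    specialize (K w ltac:(lra)).
    assert (HwQ : Cmod (w - w0) * Q <= m / 4 * eps).
    { apply Rle_trans with (m / 4 * eps / (Q + 1) * (Q + 1)); [|right; field; lra].
      apply Rmult_le_compat; try lra. apply Cmod_ge_0. }
    assert (H0 := Cmod_ge_0 (q w - q w0)).
    apply Rnot_le_lt; intros Hcontra.
    assert (m / 2 * eps <= Cmod (w - z) * Cmod (q w - q w0)).
    { apply Rmult_le_compat; lra. }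
    lra.
Qed.

Lemma unit_circle_cis (c : C) : Cmod c = 1 -> exists t, c = cis 1 t.
Proof.
  intros H. destruct c as [a b].
  assert (E : a * a + b * b = 1).
  { assert (K := Cmod2_alt (a, b)). rewrite H in K. unfold Re, Im in K; simpl in K. lra. }
  assert (Ha : -1 <= a <= 1) by nra.
  destruct (Rle_or_lt 0 b) as [Hb|Hb].
  - exists (acos a). unfold cis. rewrite Rmult_1_l, cos_acos, sin_acos by assumption.
    f_equal. replace (1 - Rsqr a) with (b * b) by (unfold Rsqr; lra). symmetry; apply sqrt_square; lra.
  - exists (- acos a). unfold cis. rewrite Rmult_1_l, cos_neg, sin_neg, cos_acos, sin_acos by assumption.
    f_equal. replace (1 - Rsqr a) with ((- b) * (- b)) by (unfold Rsqr; lra).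
    rewrite sqrt_square; lra.
Qed.

Lemma polar_form (z : C) : z <> RtoC 0 -> disc z -> exists x t, x < 0 /\ z = cexp 1 x t.
Proof.
  intros Hz Hd. assert (Hp : 0 < Cmod z) by (apply Cmod_gt_0; assumption).
  assert (Hn : RtoC (Cmod z) <> RtoC 0) by (intros K; injection K; lra).
  destruct (unit_circle_cis (z / RtoC (Cmod z))) as [t Ht].
  - rewrite Cmod_div, Cmod_R, Rabs_pos_eq by (assumption || lra). field; lra.
  - exists (ln (Cmod z)), t. split.
    + rewrite <- ln_1. apply ln_increasing; assumption.
    + unfold cexp. rewrite <- Ht, Rmult_1_l, exp_ln by assumption. field; assumption.
Qed.

Lemma ccontinuous_cexp (n x t : R) : ccontinuous (cexp n x) t.
Proof.
  change (ccontinuous (fun s => RtoC (exp (n * x)) * cis n s)%C t). ccont.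
Qed.

Lemma cexp_period (n : R) (x : R) : cis n (2 * PI) = RtoC 1 -> cexp n x (2 * PI) = cexp n x 0.
Proof.
  intros H; unfold cexp; rewrite H. f_equal. unfold cis; rewrite Rmult_0_r, cos_0, sin_0; reflexivity.
Qed.

Lemma is_pseries_C_iff (a : nat -> C) (z l : C) :
  @is_pseries C_AbsRing C_NormedModule a z l <->
  @is_series C_AbsRing C_NormedModule (fun k => Cpow z k * a k)%C l.
Proof.
  split; intros H; (refine (is_series_ext _ _ _ _ H)); intros k; reflexivity.
Qed.

Lemma Cpow_cexp (x t : R) (n : nat) :
  Cpow (cexp 1 x t) n = (RtoC (exp (INR n * x)) * Cpow (cis 1 t) n)%C.
Proof.
  unfold cexp. rewrite Cpow_mult_l, <- RtoC_pow. f_equal. f_equal.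
  induction n as [|n IH].
  - simpl. rewrite Rmult_0_l, exp_0; reflexivity.
  - rewrite S_INR. simpl pow. rewrite IH, <- exp_plus. f_equal; ring.
Qed.

Section Taylor.

Variables (f : C -> C) (M : R).
Hypothesis Hf : analytic f.
Hypothesis HM : forall z, disc z -> Cmod (f z) <= M.

Let on_circle (x t : R) : C := f (cexp 1 x t).

Lemma ccontinuous_on_circle (x t : R) : x < 0 -> ccontinuous (on_circle x) t.
Proof.
  intros Hx. apply (ccontinuous_comp f (cexp 1 x)); [|apply ccontinuous_cexp].
  destruct (Hf _ (disc_cexp x t Hx)) as [l Hl]. exact (is_derive_C_continuous f _ l Hl).
Qed.

Lemma Cmod_on_circle (x t : R) : x < 0 -> Cmod (on_circle x t) <= M.
Proof. intros Hx; apply HM, disc_cexp, Hx. Qed.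

(** [circle_mean_radius_independent] for [f(w) w^n], the power being [cexp n] in the
    coordinate [log w].  The periodicity of [cis n] makes [n] an integer, of either
    sign. *)
Lemma harmonic_radius_independent (n x1 x2 : R) :
  cis n (2 * PI) = RtoC 1 -> x1 <= x2 -> x2 < 0 ->
  (RtoC (exp (n * x2)) * circle_mean (fun t => on_circle x2 t * cis n t))%C =
  (RtoC (exp (n * x1)) * circle_mean (fun t => on_circle x1 t * cis n t))%C.
Proof.
  intros Hn H12 H2.
  assert (Eq : forall x, x < 0 ->
    circle_mean (fun t => on_circle x t * cexp n x t)%C =
    (RtoC (exp (n * x)) * circle_mean (fun t => on_circle x t * cis n t))%C).
  { intros x Hx.
    assert (Hc : forall t, ccontinuous (on_circle x) t)
      by (intros; apply ccontinuous_on_circle; assumption).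
    rewrite <- circle_mean_scal by (intros; ccont).
    apply circle_mean_ext; intros t; unfold cexp; ring. }
  rewrite <- !Eq by lra.
  apply (circle_mean_radius_independent (fun x t => on_circle x t * cexp n x t)%C);
    try assumption.
  - intros x y Hx. apply cauchy_riemann_mult; [|apply cauchy_riemann_cexp].
    apply (cauchy_riemann_comp (fun u v => f (u, v)) (cexp 1)); [|apply cauchy_riemann_cexp].
    destruct (Hf _ (disc_cexp x y Hx)) as [l Hl].
    exact (cauchy_riemann_is_derive f _ _ l Hl).
  - intros x. unfold on_circle. rewrite (cexp_period n x Hn), (cexp_period 1 x); [reflexivity|].
    exact (cis_nat_period 1).
Qed.

(** [f(w) w^(j + 1)] is bounded by [M |w|^(j + 1)], which vanishes with the radius,
    while its mean is the same on all circles. *)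
Lemma negative_harmonic_0 (x : R) (j : nat) :
  x < 0 -> circle_mean (fun t => on_circle x t * cis (INR (S j)) t)%C = RtoC 0.
Proof.
  intros Hx. set (n := INR (S j)).
  assert (Hn : 0 < n) by (apply lt_0_INR; lia).
  set (m := circle_mean (fun t => on_circle x t * cis n t)%C).
  assert (HM0 : 0 <= M) by (eapply Rle_trans; [apply Cmod_ge_0|exact (Cmod_on_circle x 0 Hx)]).
  assert (B : forall s, s < 0 -> Cmod m <= exp (n * s) * M).
  { intros s Hs.
    assert (E := harmonic_radius_independent n (x + s) x (cis_nat_period (S j)) ltac:(lra) Hx).
    fold m in E.
    assert (E' : m = (RtoC (exp (n * s)) * circle_mean (fun t => on_circle (x + s) t * cis n t))%C).
    { replace (n * (x + s)) with (n * x + n * s) in E by ring. rewrite exp_plus, RtoC_mult in E.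
      assert (Hnz : RtoC (exp (n * x)) <> RtoC 0).
      { intros K; injection K; intros K'. assert (P := exp_pos (n * x)). lra. }
      apply (f_equal (fun c => / RtoC (exp (n * x)) * c)%C) in E.
      replace (/ RtoC (exp (n * x)) * (RtoC (exp (n * x)) * m))%C with m in E by (field; assumption).
      rewrite E. field; assumption. }
    rewrite E', Cmod_mult, Cmod_R, Rabs_pos_eq by (left; apply exp_pos).
    apply Rmult_le_compat_l; [left; apply exp_pos|].
    assert (Hc : forall t, ccontinuous (on_circle (x + s)) t)
      by (intros; apply ccontinuous_on_circle; lra).
    apply circle_mean_bound; [intros; ccont|].
    intros t; rewrite Cmod_mult, Cmod_cis, Rmult_1_r. apply Cmod_on_circle; lra. }
  apply Cmod_eq_0. apply Rle_antisym; [|apply Cmod_ge_0].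
  apply Rnot_lt_le; intros Hpos.
  (* [s] is chosen so that [exp (n s) = e / (M + 1)] with [e <= |m|], which
     contradicts [B]; capping [e] by 1/2 keeps [s] negative. *)
  assert (Hm := Rmin_l (Cmod m) (1/2)). assert (Hm' := Rmin_r (Cmod m) (1/2)).
  set (e := Rmin (Cmod m) (1 / 2)) in *.
  assert (He : 0 < e) by (apply Rmin_glb_lt; lra).
  assert (Hr : 0 < e / (M + 1) < 1).
  { split; [apply Rdiv_lt_0_compat; lra|]. apply Rmult_lt_reg_r with (M + 1); [lra|].
    replace (e / (M + 1) * (M + 1)) with e by (field; lra). lra. }
  assert (Hl : ln (e / (M + 1)) < 0) by (rewrite <- ln_1; apply ln_increasing; lra).
  specialize (B (ln (e / (M + 1)) / n)).
  replace (n * (ln (e / (M + 1)) / n)) with (ln (e / (M + 1))) in B by (field; lra).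
  rewrite exp_ln in B by lra.
  assert (Hs : ln (e / (M + 1)) / n < 0).
  { apply Rmult_lt_reg_r with n; [lra|].
    replace (ln (e / (M + 1)) / n * n) with (ln (e / (M + 1))) by (field; lra). lra. }
  specialize (B Hs).
  assert (e / (M + 1) * M < e); [|lra].
  assert (e / (M + 1) * (M + 1) = e) by (field; lra). lra.
Qed.

(** Any circle gives the same values; the one of radius [exp (-1)] is used. *)
Definition taylor_coeff (j : nat) : C :=
  (RtoC (exp (INR j)) * fourier (on_circle (-1)) j)%C.

Lemma fourier_on_circle (x : R) (j : nat) :
  x < 0 -> fourier (on_circle x) j = (RtoC (exp (INR j * x)) * taylor_coeff j)%C.
Proof.
  intros Hx.
  assert (E : (RtoC (exp (- INR j * x)) * fourier (on_circle x) j)%C = taylor_coeff j).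
  { unfold taylor_coeff. replace (exp (INR j)) with (exp (- INR j * -1)) by (f_equal; ring).
    destruct (Rle_or_lt x (-1)) as [H|H].
    - symmetry. apply harmonic_radius_independent; [apply cis_neg_nat_period|lra|lra].
    - apply harmonic_radius_independent; [apply cis_neg_nat_period|lra|lra]. }
  rewrite <- E, Cmult_assoc, <- RtoC_mult, <- exp_plus.
  replace (INR j * x + - INR j * x) with 0 by ring. rewrite exp_0. ring.
Qed.

(** The mean of [f] over a small circle is close to its value at the centre. *)
Lemma taylor_coeff_0 : taylor_coeff 0 = f (RtoC 0).
Proof.
  assert (D0 : disc (RtoC 0)) by (unfold disc; rewrite Cmod_0; lra).
  destruct (Hf _ D0) as [l Hl].
  assert (K := is_derive_C_continuous f _ l Hl).
  assert (Z : Cmod (taylor_coeff 0 - f (RtoC 0)) = 0).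
  { apply cond_eq. intros eps He. rewrite Rminus_0_r, Rabs_pos_eq by apply Cmod_ge_0.
    destruct (K (eps / 2)) as [d [Hd Kd]]; [lra|].
    set (r := Rmin (d / 2) (1 / 2)).
    assert (R1 := Rmin_l (d / 2) (1 / 2)). assert (R2 := Rmin_r (d / 2) (1 / 2)). fold r in R1, R2.
    assert (R0 : 0 < r) by (apply Rmin_glb_lt; lra).
    assert (Hx : ln r < 0) by (rewrite <- ln_1; apply ln_increasing; lra).
    assert (E := fourier_on_circle (ln r) 0 Hx).
    simpl INR in E. rewrite Rmult_0_l, exp_0, Cmult_1_l in E. rewrite <- E.
    assert (Hc : forall t, ccontinuous (on_circle (ln r)) t)
      by (intros; apply ccontinuous_on_circle; lra).
    apply Rle_lt_trans with (eps / 2); [|lra].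
    rewrite <- (circle_mean_const (f (RtoC 0))). unfold fourier.
    rewrite <- circle_mean_minus by (intros; ccont).
    apply circle_mean_bound; [intros; ccont|]. intros t.
    simpl INR. rewrite Ropp_0, cis_0, Cmult_1_r. left. apply Kd.
    replace (cexp 1 (ln r) t - RtoC 0)%C with (cexp 1 (ln r) t) by ring.
    rewrite Cmod_cexp, Rmult_1_l, exp_ln by assumption. lra. }
  apply Cmod_eq_0 in Z.
  replace (taylor_coeff 0) with (taylor_coeff 0 - f (RtoC 0) + f (RtoC 0))%C by ring.
  rewrite Z; ring.
Qed.

(** Bessel's inequality on the circle of radius [exp x] bounds
    [sum_j exp (2 j x) |a_j|^2], which is at least [exp (2 N x)] times the partial
    sum; then [x] tends to 0. *)
Lemma taylor_coeff_square_sum (N : nat) :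
  sum_n (fun j => Cmod (taylor_coeff j) ^ 2) N <= M ^ 2.
Proof.
  set (S := sum_n (fun j => Cmod (taylor_coeff j) ^ 2) N).
  assert (B : forall x, x < 0 -> exp (2 * INR N * x) * S <= M ^ 2).
  { intros x Hx.
    assert (Hc : forall t, ccontinuous (on_circle x) t)
      by (intros; apply ccontinuous_on_circle; assumption).
    apply Rle_trans with (sum_n (fun j => Cmod (fourier (on_circle x) j) ^ 2) N).
    - assert (E : sum_n (fun j => exp (2 * INR N * x) * Cmod (taylor_coeff j) ^ 2) N =
        exp (2 * INR N * x) * S) by exact (@sum_n_mult_l R_Ring _ _ N).
      rewrite <- E, !sum_n_Reals. apply sum_Rle. intros j Hj.
      rewrite fourier_on_circle, Cmod_mult, Cmod_R, Rabs_pos_eq by (assumption || (left; apply exp_pos)).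
      simpl pow.
      replace (exp (INR j * x) * Cmod (taylor_coeff j) *
        (exp (INR j * x) * Cmod (taylor_coeff j) * 1)) with
        (exp (INR j * x) * exp (INR j * x) * (Cmod (taylor_coeff j) * (Cmod (taylor_coeff j) * 1))) by ring.
      rewrite <- exp_plus. apply Rmult_le_compat_r.
      + assert (H := Cmod_ge_0 (taylor_coeff j)). nra.
      + assert (Hle : 2 * INR N * x <= INR j * x + INR j * x) by (apply le_INR in Hj; nra).
        destruct Hle as [Hlt|Heq]; [left; apply exp_increasing, Hlt|right; rewrite Heq; reflexivity].
    - eapply Rle_trans; [apply bessel_inequality, Hc|].
      replace (M ^ 2) with (Re (circle_mean (fun _ => RtoC (M ^ 2)))) by (rewrite circle_mean_const; reflexivity).
      apply circle_mean_Re_le; [intros; ccont..|]. intros t.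
      rewrite <- Cmod2_conj. simpl. assert (H := Cmod_on_circle x t Hx).
      assert (H' := Cmod_ge_0 (on_circle x t)). nra. }
  assert (S0 : 0 <= S).
  { unfold S. rewrite sum_n_Reals. apply cond_pos_sum. intros j; apply pow2_ge_0. }
  apply Rnot_lt_le. intros Hlt.
  assert (HN := pos_INR N).
  (* [x] is so small that [(1 + 2 N x) S] still exceeds [M ^ 2]. *)
  pose (x := - ((S - M ^ 2) / (2 * (2 * INR N + 1) * (S + 1)))).
  assert (Hx : x < 0).
  { unfold x. apply Ropp_lt_gt_0_contravar, Rdiv_lt_0_compat; nra. }
  specialize (B x Hx).
  assert (E := exp_ineq1_le (2 * INR N * x)).
  assert (E2 : (1 + 2 * INR N * x) * S <= M ^ 2) by nra.
  assert (E3 : x * (2 * (2 * INR N + 1) * (S + 1)) = - (S - M ^ 2)) by (unfold x; field; nra).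
  assert (2 * INR N * S * 2 <= 2 * (2 * INR N + 1) * (S + 1)) by nra.
  nra.
Qed.

(** On the circle through [z], [f(w) - f(z) = (w - z) q(w)] with [q] continuous,
    and the Fourier coefficients of the two sides are related by a difference
    equation.  Its solution telescopes the Taylor partial sums at [z] up to one
    term, which tends to zero because Fourier coefficients do. *)
Lemma taylor_on_disc : power_series_on_disc taylor_coeff f.
Proof.
  intros z Hz.
  destruct (excluded_middle_informative (z = RtoC 0)) as [->|Hnz].
  { apply is_pseries_C_iff, bound_is_series_C. intros eps He. exists 0%nat. intros n _.
    assert (E : sum_n (fun k => Cpow (RtoC 0) k * taylor_coeff k)%C n = f (RtoC 0)).
    { induction n as [|n IH].
      - rewrite sum_O, <- taylor_coeff_0. simpl; ring.
      - rewrite sum_Sn, IH. unfold plus; simpl. ring. }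
    rewrite E. replace (f (RtoC 0) - f (RtoC 0))%C with (RtoC 0) by ring.
    rewrite Cmod_0; assumption. }
  destruct (polar_form z Hnz Hz) as [x [th [Hx Ez]]].
  destruct (difference_quotient_continuous f z Hf Hz) as [q [Hq Cq]].
  pose (r := exp (1 * x)). pose (zeta := cis 1 th).
  assert (Ez' : z = (RtoC r * zeta)%C) by exact Ez.
  pose (phi := on_circle x).
  pose (k := fun t => (RtoC r * q (cexp 1 x t))%C).
  assert (Hphi : forall t, ccontinuous phi t) by (intros; apply ccontinuous_on_circle, Hx).
  assert (Hphik : forall t, (phi t - f z)%C = ((cis 1 t - zeta) * k t)%C).
  { intros t. unfold phi, on_circle, k. rewrite Hq. unfold cexp at 1. fold r. rewrite Ez' at 1. ring. }
  assert (Hk : forall t, ccontinuous k t).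
  { intros t. apply ccontinuous_mult; [apply ccontinuous_const|].
    apply ccontinuous_comp; [|apply ccontinuous_cexp].
    apply Cq, disc_cexp, Hx. }
  pose (d := fun j => circle_mean (fun t => k t * cis (INR j) t)%C).
  assert (Hd_rec : forall j, d (S (S j)) = (zeta * d (S j))%C).
  { intros j.
    assert (E : circle_mean (fun t => (phi t - f z) * cis (INR (S j)) t)%C = (d (S (S j)) - zeta * d (S j))%C).
    { unfold d. rewrite <- circle_mean_scal, <- circle_mean_minus by (intros; ccont).
      apply circle_mean_ext; intros t. rewrite Hphik.
      rewrite (S_INR (S j)), Rplus_comm, <- cis_plus. ring. }
    rewrite (circle_mean_ext _ (fun t => phi t * cis (INR (S j)) t - f z * cis (INR (S j)) t)%C) in E
      by (intros; ring).
    rewrite circle_mean_minus, circle_mean_scal in E by (intros; ccont).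
    unfold phi in E. rewrite negative_harmonic_0, circle_mean_cis in E;
      [|apply not_0_INR; lia|apply cis_nat_period|exact Hx].
    replace (d (S (S j))) with (d (S (S j)) - zeta * d (S j) + zeta * d (S j))%C by ring.
    rewrite <- E. ring. }
  assert (Hzeta : Cmod zeta = 1) by apply Cmod_cis.
  (* By [Hd_rec] the negative coefficients of [k] all have the same modulus, and
     they tend to 0. *)
  assert (Hd1 : d 1%nat = RtoC 0).
  { assert (Hconst : forall j, Cmod (d (S j)) = Cmod (d 1%nat)).
    { induction j as [|j IH]; [reflexivity|]. rewrite Hd_rec, Cmod_mult, Hzeta, IH; ring. }
    assert (Hconj : forall j, Cmod (fourier (fun t => Cconj (k t)) j) = Cmod (d j)).
    { intros j. unfold fourier, d.
      rewrite (circle_mean_ext _ (fun t => Cconj (k t * cis (INR j) t))).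
      - rewrite (circle_mean_conj (fun t => k t * cis (INR j) t)%C) by (intros; ccont). apply Cmod_conj.
      - intros t. rewrite Cmult_conj, cis_conj. reflexivity. }
    assert (L := fourier_lim_0 (fun t => Cconj (k t)) ltac:(intros; ccont)).
    apply is_lim_seq_incr_1 in L.
    apply is_lim_seq_ext with (v := fun _ => Cmod (d 1%nat)) in L.
    - apply is_lim_seq_unique in L. rewrite Lim_seq_const in L. injection L as L.
      apply Cmod_eq_0, L.
    - intros j. rewrite Hconj. apply Hconst. }
  assert (Hs0 : (fourier phi 0 - f z)%C = (- (zeta * fourier k 0))%C).
  { transitivity (d 1%nat - zeta * fourier k 0)%C; [|rewrite Hd1; ring].
    rewrite <- (circle_mean_const (f z)). unfold fourier, d.
    rewrite <- circle_mean_scal, <- !circle_mean_minus by (intros; ccont).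
    apply circle_mean_ext; intros t. simpl INR. rewrite Ropp_0, cis_0, Cmult_1_r, Hphik. ring. }
  assert (Hs : forall j, fourier phi (S j) = (fourier k j - zeta * fourier k (S j))%C).
  { intros j.
    assert (E : circle_mean (fun t => (phi t - f z) * cis (- INR (S j)) t)%C = (fourier k j - zeta * fourier k (S j))%C).
    { unfold fourier. rewrite <- circle_mean_scal, <- circle_mean_minus by (intros; ccont).
      apply circle_mean_ext; intros t. rewrite Hphik.
      replace (- INR j) with (1 + - INR (S j)) by (rewrite S_INR; ring). rewrite <- (cis_plus 1). ring. }
    rewrite (circle_mean_ext _ (fun t => phi t * cis (- INR (S j)) t - f z * cis (- INR (S j)) t)%C) in E
      by (intros; ring).
    rewrite circle_mean_minus, circle_mean_scal in E by (intros; ccont).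
    rewrite circle_mean_cis in E;
      [|apply Ropp_neq_0_compat, not_0_INR; lia|apply cis_neg_nat_period].
    fold (fourier phi (S j)) in E. rewrite <- E. ring. }
  assert (Hsum : forall n, sum_n (fun j => Cpow z j * taylor_coeff j)%C n =
      (f z - Cpow zeta (S n) * fourier k n)%C).
  { assert (Hterm : forall j, (Cpow z j * taylor_coeff j)%C = (Cpow zeta j * fourier phi j)%C).
    { intros j. unfold phi. rewrite fourier_on_circle, Ez, Cpow_cexp by assumption.
      fold zeta. ring. }
    induction n as [|n IH].
    - rewrite sum_O, Hterm.
      replace (fourier phi 0) with (fourier phi 0 - f z + f z)%C by ring. rewrite Hs0.
      simpl Cpow. match goal with |- ?a = ?c => change (@eq C a c) end. ring.
    - rewrite sum_Sn, IH, Hterm, Hs.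
      match goal with |- plus ?a ?b = ?c => change (@eq C (Cplus a b) c) end.
      rewrite (Cpow_S zeta (S n)). ring. }
  apply is_pseries_C_iff, bound_is_series_C. intros eps He.
  assert (L := fourier_lim_0 k Hk).
  apply is_lim_seq_spec in L. destruct (L (mkposreal eps He)) as [N HN].
  exists N. intros n Hn. rewrite Hsum.
  replace (f z - Cpow zeta (S n) * fourier k n - f z)%C with (- (Cpow zeta (S n) * fourier k n))%C by ring.
  rewrite Cmod_opp, Cmod_mult, Cmod_pow, Hzeta, pow1, Rmult_1_l.
  specialize (HN n Hn). simpl in HN. rewrite Rminus_0_r, Rabs_pos_eq in HN by apply Cmod_ge_0. exact HN.
Qed.

End Taylor.

(** * The size of the coefficients of the Hilbert transform *)

Lemma CV_radius_ge_1_of_converges_at_1 (c : nat -> R) : ex_pseries c 1 -> Rbar_le 1 (CV_radius c).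
Proof.
  intros Hc. apply (CV_radius_bounded c).
  apply ex_pseries_R in Hc. apply ex_series_lim_0 in Hc.
  destruct (filterlim_bounded (fun n => c n * 1 ^ n)) as [B HB].
  - exists 0; exact Hc.
  - exists B; exact HB.
Qed.

(** The sum is [int_0^1 t^n p(t) dt] for [p(t) = sum_k alpha_k t^k]: integrate the
    power series up to [x < 1], bound [p] by [M], and let [x] tend to 1 by
    Abel's theorem. *)
Lemma moment_series_le (alpha : nat -> R) (M s : R) (n : nat) :
  0 <= M -> (forall t, 0 <= t < 1 -> PSeries alpha t <= M) ->
  is_series (fun k => alpha k / INR (n + k + 1)) s -> s <= M / (INR n + 1).
Proof.
  intros HM0 HM Hs.
  pose (c := PS_Int (PS_incr_n alpha n)).
  assert (Hn := pos_INR n).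
  assert (Hc1 : is_pseries c 1 s).
  { apply is_pseries_R. apply is_series_ext with c; [intros k; rewrite pow1; symmetry; apply Rmult_1_r|].
    apply is_series_decr_n with (S n); [lia|].
    match goal with |- is_series _ ?l => replace l with s end.
    - apply is_series_ext with (2 := Hs). intros k.
      change (c (S n + k)%nat) with (PS_incr_n alpha n (n + k)%nat / INR (S (n + k))).
      rewrite PS_incr_n_simplify. destruct (Compare_dec.le_lt_dec n (n + k)); [|lia].
      replace (n + k - n)%nat with k by lia. replace (S (n + k)) with (n + k + 1)%nat by lia. reflexivity.
    - assert (Z : @sum_n R_AbelianMonoid c (Init.Nat.pred (S n)) = 0).
      { rewrite sum_n_Reals. apply sum_eq_R0. intros k Hk. simpl in Hk.
        destruct k as [|k]; [reflexivity|]. unfold c, PS_Int. rewrite PS_incr_n_simplify.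
        destruct (Compare_dec.le_lt_dec n k); [lia|]. apply Rmult_0_l. }
      change (s = s + - (@sum_n R_AbelianMonoid c (Init.Nat.pred (S n)))). rewrite Z. ring. }
  assert (Hrad := CV_radius_ge_1_of_converges_at_1 c (ex_intro _ s Hc1)).
  assert (Hrad' : forall x, 0 <= x < 1 -> Rbar_lt (Rabs x) (CV_radius c)).
  { intros x Hx. apply Rbar_lt_le_trans with (Finite 1); [|exact Hrad]. simpl.
    rewrite Rabs_pos_eq; lra. }
  assert (Hbound : forall x, 0 <= x < 1 -> PSeries c x <= M / (INR n + 1)).
  { intros x Hx.
    assert (R1 : Rbar_lt (Rabs x) (CV_radius (PS_incr_n alpha n)))
      by (rewrite <- CV_radius_Int; apply Hrad', Hx).
    unfold c. rewrite <- RInt_PSeries by exact R1.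
    assert (I : is_RInt (fun t => M * t ^ n) 0 x (M * x ^ (S n) / (INR n + 1) - M * 0 ^ (S n) / (INR n + 1))).
    { apply (is_RInt_derive (fun t => M * t ^ (S n) / (INR n + 1))).
      - intros t _. auto_derive; [trivial|]. change (match n with O => 1 | S _ => INR n + 1 end) with (INR (S n)). rewrite S_INR. field; lra.
      - intros t _. apply (@ex_derive_continuous R_AbsRing R_NormedModule). auto_derive; trivial. }
    apply Rle_trans with (RInt (fun t => M * t ^ n) 0 x).
    - apply RInt_le; [lra|apply ex_RInt_PSeries; exact R1|exists (M * x ^ (S n) / (INR n + 1) - M * 0 ^ (S n) / (INR n + 1)); exact I|].
      intros t Ht. rewrite PSeries_incr_n, Rmult_comm.
      apply Rmult_le_compat_r; [apply pow_le; lra|apply HM; lra].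
    - apply (@is_RInt_unique R_CompleteNormedModule) in I. rewrite I.
      rewrite pow_i by lia. unfold Rdiv. rewrite Rmult_0_r, Rmult_0_l, Rminus_0_r.
      apply Rmult_le_compat_r; [left; apply Rinv_0_lt_compat; lra|].
      assert (x ^ S n <= 1) by (rewrite <- (pow1 (S n)); apply pow_incr; lra). nra. }
  assert (Hlim : filterlim (PSeries c) (at_left 1) (locally s)).
  { rewrite <- (is_pseries_unique c 1 s Hc1).
    destruct (Rbar_le_lt_or_eq_dec _ _ Hrad) as [Hlt|Heq].
    - assert (Hcont : continuous (PSeries c) 1).
      { apply continuity_pt_filterlim, PSeries_continuity. rewrite Rabs_R1; exact Hlt. }
      intros P HP. apply Hcont in HP. destruct HP as [e He]. exists e. intros y Hy _. apply He, Hy.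
    - assert (A := Abel c). rewrite <- Heq in A. apply A; simpl; [lra|trivial|].
      exists s; exact Hc1. }
  apply Rnot_lt_le. intros Hlt.
  destruct (Hlim (fun y => M / (INR n + 1) < y)) as [d Hd].
  { apply open_gt. exact Hlt. }
  pose (x := Rmax (1 / 2) (1 - d / 2)).
  assert (X1 : 1 / 2 <= x) by apply Rmax_l. assert (X2 : 1 - d / 2 <= x) by apply Rmax_r.
  assert (Hdp := cond_pos d).
  assert (X3 : x < 1) by (apply Rmax_lub_lt; lra).
  specialize (Hd x). assert (Hx := Hbound x ltac:(lra)).
  assert (K : M / (INR n + 1) < PSeries c x); [|lra].
  apply Hd; [|exact X3]. change (Rabs (x - 1) < d). rewrite Rabs_left1 by lra. lra.
Qed.

(** * The norm estimate *)

Lemma is_series_C_minus (u v : nat -> C) (l m : C) :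
  @is_series C_AbsRing C_NormedModule u l -> @is_series C_AbsRing C_NormedModule v m ->
  @is_series C_AbsRing C_NormedModule (fun k => u k - v k)%C (l - m)%C.
Proof. exact (is_series_minus u v l m). Qed.

Lemma is_series_C_scal (c : C) (u : nat -> C) (l : C) :
  @is_series C_AbsRing C_NormedModule u l ->
  @is_series C_AbsRing C_NormedModule (fun k => c * u k)%C (c * l)%C.
Proof. exact (is_series_scal c u l). Qed.

Lemma Cmod_pos_real (x : R) : 0 <= x -> Cmod (RtoC x) = x.
Proof. intros H; rewrite Cmod_R, Rabs_pos_eq; trivial. Qed.

Lemma disc_real (t : R) : 0 <= t < 1 -> disc (RtoC t).
Proof. intros Ht; unfold disc; rewrite Cmod_pos_real; lra. Qed.

(** Multiplying the series by the conjugate of its sum [s] makes it real with sum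
    [|s|^2]; its generating function is then the real part of [Cconj s * f], which is
    at most [|s| M]. *)
Lemma hilbert_coeff_bound (f : C -> C) (M : R) (a : nat -> C) (n : nat) (s : C) :
  (forall z, disc z -> Cmod (f z) <= M) -> power_series_on_disc a f ->
  @is_series C_AbsRing C_NormedModule (fun k => Cdiv (a k) (RtoC (INR (n + k + 1)))) s ->
  Cmod s <= M / (INR n + 1).
Proof.
  intros HM Ha Hs.
  assert (HM0 : 0 <= M).
  { eapply Rle_trans; [apply Cmod_ge_0|apply (HM (RtoC 0))]. apply disc_real; lra. }
  assert (Hn := pos_INR n). assert (Hs0 := Cmod_ge_0 s).
  assert (B : Cmod s ^ 2 <= (Cmod s * M) / (INR n + 1)).
  { apply (moment_series_le (fun k => Re (Cconj s * a k)) (Cmod s * M) (Cmod s ^ 2) n).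
    - apply Rmult_le_pos; assumption.
    - intros t Ht.
      assert (P : is_pseries (fun k => Re (Cconj s * a k)) t (Re (Cconj s * f (RtoC t)))).
      { apply is_pseries_R.
        assert (Q := Ha (RtoC t) (disc_real t Ht)). apply (proj1 (is_pseries_C_iff _ _ _)) in Q.
        apply (is_series_C_scal (Cconj s)), is_series_Re in Q.
        refine (is_series_ext _ _ _ _ Q). intros k.
        rewrite <- RtoC_pow. unfold Re; simpl; ring. }
      rewrite (is_pseries_unique _ _ _ P).
      eapply Rle_trans; [apply Rle_abs|]. eapply Rle_trans; [apply re_le_Cmod|].
      rewrite Cmod_mult, Cmod_conj. apply Rmult_le_compat_l; [assumption|].
      apply HM, disc_real, Ht.
    - apply (is_series_C_scal (Cconj s)), is_series_Re in Hs.
      rewrite Cconj_mult_Cmod in Hs. refine (is_series_ext _ _ _ _ Hs). intros k.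
      assert (Hk : INR (n + k + 1) <> 0) by (apply not_0_INR; lia).
      unfold Re, Cdiv, Cinv; simpl. field; assumption. }
  destruct (Req_dec (Cmod s) 0) as [Z|NZ].
  - rewrite Z. apply Rmult_le_pos; [assumption|]. left; apply Rinv_0_lt_compat; lra.
  - apply Rmult_le_reg_l with (Cmod s); [lra|].
    replace (Cmod s * (M / (INR n + 1))) with (Cmod s * M / (INR n + 1)) by (field; lra).
    simpl in B; lra.
Qed.

Lemma series_C_bound (u : nat -> C) (l : C) (B : R) :
  @is_series C_AbsRing C_NormedModule u l -> (forall n, Cmod (sum_n u n) <= B) -> Cmod l <= B.
Proof.
  intros Hu HB. apply le_epsilon. intros eps He.
  destruct (is_series_C_bound u l Hu eps He) as [N HN].
  specialize (HN N (le_n N)). specialize (HB N).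
  rewrite Cmod_minus_sym in HN.
  assert (T := Cmod_triangle_minus l (sum_n u N)). lra.
Qed.

(** A total sum, meaningful for absolutely convergent series, so that a function can
    be defined by its power series. *)
Definition csum (u : nat -> C) : C := (Series (fun k => Re (u k)), Series (fun k => Im (u k))).

Lemma csum_correct (u : nat -> C) (v : nat -> R) :
  (forall n, Cmod (u n) <= v n) -> ex_series v ->
  @is_series C_AbsRing C_NormedModule u (csum u).
Proof.
  intros H Hv. apply is_series_C_of_Re_Im; apply Series_correct;
    apply (@ex_series_le R_AbsRing R_CompleteNormedModule _ v); trivial; intros n;
    (eapply Rle_trans; [|apply H]).
  - apply re_le_Cmod.
  - apply im_le_Cmod.
Qed.

(** The remainder [E n] of the first-order expansion of [w ^ n] at [z] satisfies
    [E (n + 1) = w E n + n z^(n - 1) (w - z)^2].  The factor [rho ^ 2] stands for the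
    exponent [n - 2] on the right, which would not be a natural number. *)
Lemma Cpow_second_order (z w : C) (rho : R) (n : nat) :
  0 < rho -> Cmod z <= rho -> Cmod w <= rho ->
  rho ^ 2 * Cmod (Cpow w n - Cpow z n - RtoC (INR n) * Cpow z (pred n) * (w - z)) <=
  INR n ^ 2 * rho ^ n * Cmod (w - z) ^ 2.
Proof.
  intros Hr Hz Hw. assert (Hd := Cmod_ge_0 (w - z)).
  induction n as [|n IH].
  - simpl. replace (1 - 1 - RtoC 0 * 1 * (w - z))%C with (RtoC 0) by ring. rewrite Cmod_0. lra.
  - assert (En : (RtoC (INR n) * (z * Cpow z (pred n)))%C = (RtoC (INR n) * Cpow z n)%C).
    { destruct n as [|n]; [simpl; ring|reflexivity]. }
    set (E := (Cpow w n - Cpow z n - RtoC (INR n) * Cpow z (pred n) * (w - z))%C) in *.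
    replace (Cpow w (S n) - Cpow z (S n) - RtoC (INR (S n)) * Cpow z (pred (S n)) * (w - z))%C
      with (w * E + RtoC (INR n) * Cpow z (pred n) * ((w - z) * (w - z)))%C.
    2: { rewrite S_INR, RtoC_plus. simpl pred. rewrite !Cpow_S. unfold E.
         replace ((RtoC (INR n) + 1) * Cpow z n * (w - z))%C
           with (RtoC (INR n) * (z * Cpow z (pred n)) * (w - z) + Cpow z n * (w - z))%C by (rewrite En; ring).
         ring. }
    assert (Hn := pos_INR n).
    assert (T := Cmod_triangle (w * E) (RtoC (INR n) * Cpow z (pred n) * ((w - z) * (w - z)))).
    rewrite !Cmod_mult, Cmod_pow, Cmod_pos_real in T by assumption.
    assert (HE := Cmod_ge_0 E).
    assert (P1 : rho ^ 2 * (Cmod w * Cmod E) <= rho * (INR n ^ 2 * rho ^ n * Cmod (w - z) ^ 2)).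
    { apply Rle_trans with (rho * (rho ^ 2 * Cmod E)).
      - assert (0 <= rho ^ 2) by (apply pow_le; lra).
        assert (Cmod w * Cmod E <= rho * Cmod E) by (apply Rmult_le_compat_r; assumption). nra.
      - apply Rmult_le_compat_l; lra. }
    assert (P2 : rho ^ 2 * (INR n * Cmod z ^ pred n) <= INR n * rho ^ (S n)).
    { destruct n as [|n]; [simpl; lra|]. simpl pred.
      assert (Cmod z ^ n <= rho ^ n) by (apply pow_incr; split; [apply Cmod_ge_0|assumption]).
      replace (rho ^ S (S n)) with (rho ^ 2 * rho ^ n) by (simpl; ring).
      assert (0 <= rho ^ 2 * INR (S n)) by (apply Rmult_le_pos; [apply pow_le; lra|assumption]). nra. }
    rewrite S_INR.
    apply Rle_trans with (rho ^ 2 * (Cmod w * Cmod E) +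
      rho ^ 2 * (INR n * Cmod z ^ pred n) * Cmod (w - z) ^ 2).
    { assert (0 <= rho ^ 2) by (apply pow_le; lra). nra. }
    assert (P3 : 0 <= Cmod (w - z) ^ 2) by (apply pow_le; assumption).
    assert (P4 : 0 <= rho ^ S n * Cmod (w - z) ^ 2) by (apply Rmult_le_pos; [apply pow_le; lra|assumption]).
    replace (rho * (INR n ^ 2 * rho ^ n * Cmod (w - z) ^ 2)) with (INR n ^ 2 * (rho ^ S n * Cmod (w - z) ^ 2)) in P1
      by (simpl; ring).
    replace ((INR n + 1) ^ 2 * rho ^ S n * Cmod (w - z) ^ 2) with
      ((INR n + 1) ^ 2 * (rho ^ S n * Cmod (w - z) ^ 2)) by ring.
    apply Rmult_le_compat_r with (r := Cmod (w - z) ^ 2) in P2; [|assumption]. nra.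
Qed.

(** The bound [n |b_n| <= M] controls the sum of the series, its derivative, and the
    remainder of the first-order expansion. *)
Section Coefficients.

Variables (b : nat -> C) (M : R).
Hypothesis HM0 : 0 <= M.
Hypothesis Hb : forall n, Cmod (b n) <= M / (INR n + 1).

Lemma coeff_times_index (n : nat) : Cmod (b n) * (INR n + 1) <= M.
Proof.
  assert (Hn := pos_INR n).
  apply Rle_trans with (M / (INR n + 1) * (INR n + 1)); [|right; field; lra].
  apply Rmult_le_compat_r; [lra|apply Hb].
Qed.

Lemma coeff_le (n : nat) : Cmod (b n) <= M.
Proof.
  assert (H := coeff_times_index n). assert (Hn := pos_INR n). assert (H0 := Cmod_ge_0 (b n)). nra.
Qed.

Lemma ex_series_scaled_geom (r : R) : 0 <= r < 1 -> ex_series (fun n => M * r ^ n).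
Proof.
  intros Hr. exists (M * / (1 - r)). apply (is_series_scal M (fun n => r ^ n)).
  apply is_series_geom. rewrite Rabs_pos_eq; lra.
Qed.

Lemma power_series_converges :
  power_series_on_disc b (fun z => csum (fun n => Cpow z n * b n)%C).
Proof.
  intros z Hz. apply is_pseries_C_iff. assert (Hz0 := Cmod_ge_0 z). unfold disc in Hz.
  apply csum_correct with (fun n => M * Cmod z ^ n); [|apply ex_series_scaled_geom; lra].
  intros n. rewrite Cmod_mult, Cmod_pow, Rmult_comm.
  apply Rmult_le_compat_r; [apply pow_le; assumption|apply coeff_le].
Qed.

Lemma sum_index_geom_le (rho : R) (n : nat) :
  0 < rho < 1 -> (1 - rho) ^ 2 * sum_n (fun j => INR j * rho ^ j) n <= rho.
Proof.
  intros Hr.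
  assert (E : (1 - rho) ^ 2 * sum_n (fun j => INR j * rho ^ j) n =
    rho * (1 - rho ^ n * (1 + INR n * (1 - rho)))).
  { induction n as [|n IH].
    - rewrite sum_O. simpl; ring.
    - rewrite sum_Sn, S_INR.
      match goal with |- _ * plus ?a ?b = _ => change (plus a b) with (a + b) end.
      rewrite Rmult_plus_distr_l, IH. simpl; ring. }
  rewrite E. assert (P : 0 <= rho ^ n) by (apply pow_le; lra). assert (Hn := pos_INR n).
  assert (0 <= rho ^ n * (1 + INR n * (1 - rho))) by (apply Rmult_le_pos; nra). nra.
Qed.

(** Termwise differentiation: summing [Cpow_second_order] against [n |b_n| <= M], the
    remainder of the first-order expansion at [z] is at most [K |w - z|^2], where [K]
    comes from the convergent series [sum_n n rho^n]. *)
Lemma power_series_derivative (g : C -> C) (z : C) :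
  power_series_on_disc b g -> disc z -> exists l,
  @is_derive C_AbsRing C_NormedModule g z l /\
  @is_series C_AbsRing C_NormedModule (fun n => RtoC (INR n) * Cpow z (pred n) * b n)%C l.
Proof.
  intros Hg Hz. unfold disc in Hz. assert (Hz0 := Cmod_ge_0 z).
  exists (csum (fun n => RtoC (INR n) * Cpow z (pred n) * b n)%C).
  set (l := csum _).
  assert (Hl : @is_series C_AbsRing C_NormedModule (fun n => RtoC (INR n) * Cpow z (pred n) * b n)%C l).
  { apply csum_correct with (fun n => M * Cmod z ^ (pred n)).
    - intros n. rewrite !Cmod_mult, Cmod_pow, Cmod_pos_real by apply pos_INR.
      assert (H := coeff_times_index n). assert (H0 := Cmod_ge_0 (b n)).
      assert (P : 0 <= Cmod z ^ pred n) by (apply pow_le; assumption).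
      replace (INR n * Cmod z ^ pred n * Cmod (b n)) with (Cmod (b n) * INR n * Cmod z ^ pred n) by ring.
      apply Rmult_le_compat_r; lra.
    - apply ex_series_incr_1. simpl pred. apply ex_series_scaled_geom; lra. }
  split; [|exact Hl].
  pose (rho := (1 + Cmod z) / 2).
  assert (Hr : 0 < rho < 1) by (unfold rho; lra).
  assert (Hrz : Cmod z < rho) by (unfold rho; lra).
  pose (K := M / (rho * (1 - rho) ^ 2)).
  assert (Hp2 : 0 < (1 - rho) ^ 2) by (apply pow_lt; lra).
  assert (HK : 0 <= K).
  { unfold K. apply Rmult_le_pos; [assumption|]. left; apply Rinv_0_lt_compat, Rmult_lt_0_compat; lra. }
  assert (Key : forall w, Cmod w <= rho -> Cmod (g w - g z - l * (w - z)) <= K * Cmod (w - z) ^ 2).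
  { intros w Hw.
    assert (Sw := Hg w ltac:(unfold disc; lra)). assert (Sz := Hg z Hz).
    apply (proj1 (is_pseries_C_iff _ _ _)) in Sw. apply (proj1 (is_pseries_C_iff _ _ _)) in Sz.
    assert (T := is_series_C_minus _ _ _ _ (is_series_C_minus _ _ _ _ Sw Sz) (is_series_C_scal (w - z) _ _ Hl)).
    replace (g w - g z - l * (w - z))%C with (g w - g z - (w - z) * l)%C by ring.
    apply series_C_bound with (1 := T). intros n.
    assert (Hd2 : 0 <= Cmod (w - z) ^ 2) by (apply pow_le, Cmod_ge_0).
    apply Rmult_le_reg_l with (rho ^ 2); [apply pow_lt; lra|].
    apply Rle_trans with (M * sum_n (fun j => INR j * rho ^ j) n * Cmod (w - z) ^ 2).
    - assert (TT : forall j, rho ^ 2 * Cmod (Cpow w j * b j - Cpow z j * b j -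
        (w - z) * (RtoC (INR j) * Cpow z (pred j) * b j)) <= M * (INR j * rho ^ j) * Cmod (w - z) ^ 2).
      { intros j.
        replace (Cpow w j * b j - Cpow z j * b j - (w - z) * (RtoC (INR j) * Cpow z (pred j) * b j))%C
          with (b j * (Cpow w j - Cpow z j - RtoC (INR j) * Cpow z (pred j) * (w - z)))%C by ring.
        rewrite Cmod_mult.
        assert (S2 := Cpow_second_order z w rho j ltac:(lra) ltac:(lra) Hw).
        set (X := Cmod (Cpow w j - _ - _)) in *.
        assert (B0 := Cmod_ge_0 (b j)). assert (B1 := coeff_times_index j). assert (Hj := pos_INR j).
        apply Rle_trans with (Cmod (b j) * (INR j ^ 2 * rho ^ j * Cmod (w - z) ^ 2)).
        - replace (rho ^ 2 * (Cmod (b j) * X)) with (Cmod (b j) * (rho ^ 2 * X)) by ring.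
          apply Rmult_le_compat_l; assumption.
        - replace (Cmod (b j) * (INR j ^ 2 * rho ^ j * Cmod (w - z) ^ 2)) with
            ((Cmod (b j) * INR j) * (INR j * rho ^ j * Cmod (w - z) ^ 2)) by ring.
          rewrite !Rmult_assoc. rewrite <- (Rmult_assoc (Cmod (b j))).
          apply Rmult_le_compat_r; [|lra].
          apply Rmult_le_pos; [assumption|apply Rmult_le_pos; [apply pow_le; lra|assumption]]. }
      induction n as [|n IH].
      + rewrite !sum_O. apply TT.
      + rewrite !sum_Sn.
        match goal with |- _ * Cmod (plus ?a ?b) <= _ =>
          apply Rle_trans with (rho ^ 2 * (Cmod a + Cmod b));
            [apply Rmult_le_compat_l; [apply pow_le; lra|apply (Cmod_triangle a b)]|] end.
        specialize (TT (S n)). unfold plus; simpl AbelianMonoid.plus.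
        match goal with |- _ <= M * ?s * _ => change s with (sum_n (fun j => INR j * rho ^ j) n + INR (S n) * rho ^ (S n)) end.
        lra.
    - assert (G := sum_index_geom_le rho n Hr).
      set (S := sum_n (fun j => INR j * rho ^ j) n) in *.
      rewrite <- Rmult_assoc. apply Rmult_le_compat_r; [assumption|].
      replace (rho ^ 2 * K) with (M * (rho / (1 - rho) ^ 2)) by (unfold K; field; lra).
      apply Rmult_le_compat_l; [assumption|].
      apply Rmult_le_reg_l with ((1 - rho) ^ 2); [assumption|].
      replace ((1 - rho) ^ 2 * (rho / (1 - rho) ^ 2)) with rho by (field; lra). exact G. }
  apply bound_is_derive_C. intros eps He.
  assert (Hq : 0 < eps / (K + 1)) by (apply Rdiv_lt_0_compat; lra).
  exists (Rmin (rho - Cmod z) (eps / (K + 1))). split; [apply Rmin_glb_lt; lra|].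
  intros w Hw.
  assert (L1 := Rmin_l (rho - Cmod z) (eps / (K + 1))).
  assert (L2 := Rmin_r (rho - Cmod z) (eps / (K + 1))).
  assert (Tw := Cmod_triangle_minus w z). assert (Hd := Cmod_ge_0 (w - z)).
  eapply Rle_trans; [apply Key; lra|].
  assert (K * Cmod (w - z) <= eps).
  { apply Rle_trans with ((K + 1) * (eps / (K + 1))); [|right; field; lra].
    apply Rmult_le_compat; lra. }
  simpl; nra.
Qed.

Lemma power_series_analytic (g : C -> C) : power_series_on_disc b g -> analytic g.
Proof.
  intros Hg z Hz. destruct (power_series_derivative g z Hg Hz) as [l [Hl _]]. exists l; exact Hl.
Qed.

(** Since [n |b_n| <= M], the derivative is dominated by [M] times a geometric
    series. *)
Lemma power_series_derivative_bound (g : C -> C) (z : C) :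
  power_series_on_disc b g -> disc z -> (1 - Cmod z) * Cmod (C_derive g z) <= M.
Proof.
  intros Hg Hz. destruct (power_series_derivative g z Hg Hz) as [l [Hl Sl]].
  rewrite (is_C_derive_unique g z l Hl).
  unfold disc in Hz. assert (Hz0 := Cmod_ge_0 z).
  apply Rmult_le_reg_l with (/ (1 - Cmod z)); [apply Rinv_0_lt_compat; lra|].
  replace (/ (1 - Cmod z) * ((1 - Cmod z) * Cmod l)) with (Cmod l) by (field; lra).
  apply series_C_bound with (1 := Sl). intros n.
  apply Rle_trans with (M * ((1 - Cmod z ^ n) / (1 - Cmod z))).
  - induction n as [|n IH].
    + rewrite sum_O. simpl. replace (RtoC 0 * 1 * b 0%nat)%C with (RtoC 0) by ring. rewrite Cmod_0. right; field; lra.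
    + rewrite sum_Sn. eapply Rle_trans; [apply (Cmod_triangle (sum_n _ n))|].
      simpl pred. rewrite !Cmod_mult, Cmod_pow, Cmod_pos_real by apply pos_INR.
      assert (H := coeff_times_index (S n)). assert (H0 := Cmod_ge_0 (b (S n))).
      assert (P : 0 <= Cmod z ^ n) by (apply pow_le; assumption).
      assert (Q : INR (S n) * Cmod z ^ n * Cmod (b (S n)) <= M * Cmod z ^ n).
      { replace (INR (S n) * Cmod z ^ n * Cmod (b (S n))) with (Cmod (b (S n)) * INR (S n) * Cmod z ^ n) by ring.
        apply Rmult_le_compat_r; lra. }
      replace (M * ((1 - Cmod z ^ S n) / (1 - Cmod z))) with
        (M * ((1 - Cmod z ^ n) / (1 - Cmod z)) + M * Cmod z ^ n) by (simpl; field; lra).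
      lra.
  - rewrite Rmult_comm. apply Rmult_le_compat_r; [assumption|].
    unfold Rdiv. rewrite <- (Rmult_1_l (/ (1 - Cmod z))) at 2.
    apply Rmult_le_compat_r; [left; apply Rinv_0_lt_compat; lra|].
    assert (P : 0 <= Cmod z ^ n) by (apply pow_le; assumption). lra.
Qed.

End Coefficients.

Lemma power_series_at_0 (b : nat -> C) (g : C -> C) :
  power_series_on_disc b g -> g (RtoC 0) = b 0%nat.
Proof.
  intros Hg. assert (H := Hg (RtoC 0) ltac:(apply disc_real; lra)).
  apply (proj1 (is_pseries_C_iff _ _ _)) in H.
  assert (Z : Cmod (b 0%nat - g (RtoC 0)) = 0).
  { apply cond_eq. intros eps He. rewrite Rminus_0_r, Rabs_pos_eq by apply Cmod_ge_0.
    destruct (is_series_C_bound _ _ H eps He) as [N HN]. specialize (HN N (le_n N)).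
    assert (E : sum_n (fun k => Cpow (RtoC 0) k * b k)%C N = b 0%nat).
    { clear HN. induction N as [|n IH].
      - rewrite sum_O. simpl; ring.
      - rewrite sum_Sn, IH. unfold plus; simpl. ring. }
    rewrite E in HN. exact HN. }
  apply Cmod_eq_0 in Z. replace (b 0%nat) with (b 0%nat - g (RtoC 0) + g (RtoC 0))%C by ring.
  rewrite Z; ring.
Qed.

Lemma bloch_norm_le (b : nat -> C) (M : R) (g : C -> C) :
  0 <= M -> (forall n, Cmod (b n) <= M / (INR n + 1)) -> power_series_on_disc b g ->
  Rbar_le (bloch_norm g) (Finite (3 * M)).
Proof.
  intros HM Hb Hg. unfold bloch_norm.
  assert (H0 : Cmod (g (RtoC 0)) <= M).
  { rewrite (power_series_at_0 b g Hg). apply (coeff_le b M Hb). }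
  match goal with |- Rbar_le (Rbar_plus _ (Lub_Rbar ?E)) _ =>
    assert (HL : Rbar_le (Lub_Rbar E) (Finite (2 * M))) end.
  { apply (proj2 (Lub_Rbar_correct _)). intros x [z [Hz ->]]. simpl.
    assert (D := power_series_derivative_bound b M HM Hb g z Hg Hz).
    unfold disc in Hz. assert (Hz0 := Cmod_ge_0 z).
    replace ((1 - Cmod z * (Cmod z * 1)) * Cmod (C_derive g z)) with
      ((1 + Cmod z) * ((1 - Cmod z) * Cmod (C_derive g z))) by ring.
    assert (P : 0 <= (1 - Cmod z) * Cmod (C_derive g z)) by (apply Rmult_le_pos; [lra|apply Cmod_ge_0]).
    nra. }
  destruct (Lub_Rbar _) as [r| |]; simpl in HL |- *; try contradiction; trivial. lra.
Qed.

Lemma Hinf_bound (f : C -> C) :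
  in_Hinf f -> exists M, Hinf_norm f = Finite M /\ 0 <= M /\ forall z, disc z -> Cmod (f z) <= M.
Proof.
  intros [_ Hlt].
  destruct (Lub_Rbar_correct (fun x => exists z, disc z /\ x = Cmod (f z))) as [Hub _].
  fold (Hinf_norm f) in Hub.
  assert (Hub' : forall z, disc z -> Rbar_le (Cmod (f z)) (Hinf_norm f)).
  { intros z Hz; apply Hub; exists z; auto. }
  assert (D0 : disc (RtoC 0)) by (apply disc_real; lra).
  destruct (Hinf_norm f) as [M| |].
  - exists M; split; [reflexivity|split; [|exact Hub']].
    eapply Rle_trans; [apply Cmod_ge_0|exact (Hub' _ D0)].
  - destruct Hlt.
  - destruct (Hub' _ D0).
Qed.

Lemma hilbert_bloch_norm_le (f g : C -> C) (M : R) :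
  0 <= M -> (forall z, disc z -> Cmod (f z) <= M) -> hilbert f g ->
  Rbar_le (bloch_norm g) (Finite (3 * M)).
Proof.
  intros HM Hf [_ [_ [a [b [Ha [Hab Hb]]]]]].
  apply bloch_norm_le with b; try assumption.
  intros n; apply (hilbert_coeff_bound f M a n (b n) Hf Ha (Hab n)).
Qed.

Lemma ex_series_inv_squares : ex_series (fun k => / (INR k + 1) ^ 2).
Proof.
  apply ex_series_nonneg_bounded with 2.
  - intros n. left; apply Rinv_0_lt_compat, pow_lt. assert (H := pos_INR n); lra.
  - assert (B : forall n, sum_n (fun k => / (INR k + 1) ^ 2) n <= 2 - / (INR n + 1)).
    { induction n as [|n IH].
      - rewrite sum_O. simpl. right; field.
      - rewrite sum_Sn. eapply Rle_trans; [apply Rplus_le_compat_r, IH|].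
        rewrite S_INR. assert (H := pos_INR n). set (x := INR n) in *.
        assert (/ (x + 1 + 1) ^ 2 <= / (x + 1) - / (x + 1 + 1)); [|lra].
        replace (/ (x + 1) - / (x + 1 + 1)) with (/ ((x + 1) * (x + 1 + 1))) by (field; lra).
        apply Rinv_le_contravar; nra. }
    intros n. specialize (B n). assert (H := pos_INR n).
    assert (0 < / (INR n + 1)) by (apply Rinv_0_lt_compat; lra). lra.
Qed.

(** Square summability of the coefficients, against [1/(k+1)], makes the rows of
    the Hilbert matrix summable. *)
Lemma hilbert_exists (f : C -> C) (M : R) :
  analytic f -> 0 <= M -> (forall z, disc z -> Cmod (f z) <= M) -> exists g, hilbert f g.
Proof.
  intros Hf HM0 HM.
  pose (a := taylor_coeff f).
  pose (b := fun n : nat => csum (fun k => Cdiv (a k) (RtoC (INR (n + k + 1))))).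
  assert (Ha : power_series_on_disc a f) by exact (taylor_on_disc f M Hf HM).
  assert (Hsq : ex_series (fun k => Cmod (a k) ^ 2)).
  { apply ex_series_nonneg_bounded with (M ^ 2).
    - intros n; apply pow2_ge_0.
    - exact (taylor_coeff_square_sum f M Hf HM). }
  assert (Hab : forall n, @is_series C_AbsRing C_NormedModule
    (fun k => Cdiv (a k) (RtoC (INR (n + k + 1)))) (b n)).
  { intros n.
    apply csum_correct with (fun k => Cmod (a k) ^ 2 + / (INR k + 1) ^ 2).
    - intros k. assert (Hk := pos_INR k). assert (Hn := pos_INR n).
      assert (E : INR (n + k + 1) = INR n + INR k + 1) by (rewrite !plus_INR; reflexivity).
      rewrite Cmod_div, Cmod_pos_real; [|apply pos_INR|].
      2: { intros K; injection K; rewrite E; lra. }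
      rewrite E. rewrite <- pow_inv.
      assert (I : / (INR n + INR k + 1) <= / (INR k + 1)) by (apply Rinv_le_contravar; lra).
      assert (I0 : 0 < / (INR n + INR k + 1)) by (apply Rinv_0_lt_compat; lra).
      assert (A := Cmod_ge_0 (a k)). unfold Rdiv.
      apply Rle_trans with (Cmod (a k) * / (INR k + 1)); [apply Rmult_le_compat_l; assumption|].
      set (u := Cmod (a k)) in *; set (v := / (INR k + 1)) in *.
      assert (0 <= (u - v) ^ 2) by apply pow2_ge_0. assert (0 <= u * v) by (apply Rmult_le_pos; lra). lra.
    - apply (ex_series_plus (fun k => Cmod (a k) ^ 2)); [exact Hsq|exact ex_series_inv_squares]. }
  assert (Hb : forall n, Cmod (b n) <= M / (INR n + 1)).
  { intros n; apply (hilbert_coeff_bound f M a n (b n) HM Ha (Hab n)). }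
  exists (fun z => csum (fun n => Cpow z n * b n)%C).
  assert (Hg := power_series_converges b M Hb).
  split; [assumption|split; [exact (power_series_analytic b M HM0 Hb _ Hg)|]].
  exists a, b; auto.
Qed.

(** * The constant function 1 *)

Definition inv_succ (n : nat) : C := RtoC (/ (INR n + 1)).

Lemma Cmod_inv_succ (n : nat) : Cmod (inv_succ n) <= 1 / (INR n + 1).
Proof.
  assert (H := pos_INR n). unfold inv_succ. rewrite Cmod_pos_real by (left; apply Rinv_0_lt_compat; lra).
  right; field; lra.
Qed.

(** The [n]-th term is [(1 - 1 / (n + 1)) r^(n - 1)].  Here [1 / (n + 1)] is at most [d]
    up to an error [(1 / n - 1 / (n + 1)) / d], and these errors telescope to at most
    [1 / d]. *)
Lemma inv_succ_derivative_lower (r d : R) (l : C) :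
  0 < r < 1 -> 0 < d < 1 ->
  @is_series C_AbsRing C_NormedModule
    (fun n => RtoC (INR n) * Cpow (RtoC r) (pred n) * inv_succ n)%C l ->
  (1 - d) / (1 - r) - / d <= Re l.
Proof.
  intros Hr Hd Hl.
  assert (Hd' : 1 < / d) by (rewrite <- Rinv_1; apply Rinv_lt_contravar; lra).
  apply is_series_Re in Hl.
  assert (Hs : is_series (fun n => INR n / (INR n + 1) * r ^ pred n) (Re l)).
  { refine (is_series_ext _ _ _ _ Hl). intros n. assert (Hn := pos_INR n).
    unfold inv_succ. rewrite <- RtoC_pow, <- !RtoC_mult. unfold Re; simpl. field; lra. }
  assert (L : forall n, (1 - d) * ((1 - r ^ n) / (1 - r)) - / d * (1 - / (INR n + 1)) <=
     sum_n (fun n => INR n / (INR n + 1) * r ^ pred n) n).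
  { induction n as [|n IH].
    - rewrite sum_O. simpl. right. field; lra.
    - rewrite sum_Sn. eapply Rle_trans; [|apply Rplus_le_compat_r, IH].
      simpl pred. rewrite S_INR. assert (Hn := pos_INR n). set (x := INR n) in *.
      assert (P0 : 0 <= r ^ n) by (apply pow_le; lra).
      assert (P1 : r ^ n <= 1) by (rewrite <- (pow1 n); apply pow_incr; lra).
      replace ((1 - r ^ S n) / (1 - r)) with ((1 - r ^ n) / (1 - r) + r ^ n) by (simpl; field; lra).
      (* Either [1 / (x + 2) <= d], or [1 / d > x + 2] and the error term suffices. *)
      assert (Q : / (x + 1 + 1) <= d + / d * (/ (x + 1) - / (x + 1 + 1))).
      { replace (/ (x + 1) - / (x + 1 + 1)) with (/ (x + 1) * / (x + 1 + 1)) by (field; lra).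
        assert (I1 : 0 < / (x + 1)) by (apply Rinv_0_lt_compat; lra).
        assert (I2 : 0 < / (x + 1 + 1)) by (apply Rinv_0_lt_compat; lra).
        destruct (Rle_or_lt (/ (x + 1 + 1)) d) as [H|H].
        - assert (0 <= / d * (/ (x + 1) * / (x + 1 + 1))); [|lra].
          repeat apply Rmult_le_pos; lra.
        - assert (H1 : x + 1 + 1 < / d).
          { rewrite <- (Rinv_inv (x + 1 + 1)). apply Rinv_lt_contravar; [apply Rmult_lt_0_compat; lra|assumption]. }
          assert (H2 : 1 <= / d * / (x + 1)).
          { apply Rmult_le_reg_r with (x + 1); [lra|]. rewrite Rmult_assoc, Rinv_l by lra. lra. }
          rewrite <- Rmult_assoc. nra. }
      assert (E : (x + 1) / (x + 1 + 1) = 1 - / (x + 1 + 1)) by (field; lra).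
      rewrite E.
      assert (N : 0 <= / d * (/ (x + 1) - / (x + 1 + 1))).
      { apply Rmult_le_pos; [lra|].
        assert (/ (x + 1 + 1) <= / (x + 1)) by (apply Rinv_le_contravar; lra). lra. }
      set (t := / d * (/ (x + 1) - / (x + 1 + 1))) in *.
      assert (T : (1 - d) * r ^ n - t <= (1 - / (x + 1 + 1)) * r ^ n) by nra.
      assert (E2 : / d * (1 - / (x + 1 + 1)) = / d * (1 - / (x + 1)) + t) by (unfold t; ring).
      rewrite E2. lra. }
  assert (U : forall n, sum_n (fun n => INR n / (INR n + 1) * r ^ pred n) n <= Re l).
  { apply (is_lim_seq_incr_compare _ _ Hs). intros n. rewrite sum_Sn.
    assert (Hn := pos_INR (S n)).
    assert (0 <= INR (S n) / (INR (S n) + 1) * r ^ pred (S n)).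
    { repeat apply Rmult_le_pos; [assumption|left; apply Rinv_0_lt_compat; lra|apply pow_le; lra]. }
    match goal with |- ?a <= plus ?a ?b => change (a <= a + b) end. lra. }
  apply le_epsilon. intros eps He.
  assert (Hc : 0 < (1 - d) / (1 - r)) by (apply Rdiv_lt_0_compat; lra).
  destruct (pow_lt_1_zero r ltac:(rewrite Rabs_pos_eq; lra) (eps / ((1 - d) / (1 - r)))) as [N HN].
  { apply Rdiv_lt_0_compat; assumption. }
  specialize (HN N (le_n N)). rewrite Rabs_pos_eq in HN by (apply pow_le; lra).
  specialize (L N). specialize (U N).
  assert (I : 0 < / (INR N + 1)) by (apply Rinv_0_lt_compat; assert (H := pos_INR N); lra).
  assert (E : (1 - d) * ((1 - r ^ N) / (1 - r)) = (1 - d) / (1 - r) - (1 - d) / (1 - r) * r ^ N) by (field; lra).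
  apply Rmult_lt_compat_l with (r := (1 - d) / (1 - r)) in HN; [|assumption].
  replace ((1 - d) / (1 - r) * (eps / ((1 - d) / (1 - r)))) with eps in HN by (field; lra).
  assert (/ d * (1 - / (INR N + 1)) <= / d) by nra. lra.
Qed.

(** At [r] with [1 - r = d ^ 2] the lower bound gives
    [(1 - r ^ 2) g'(r) >= (1 + r) (1 - 2 d)], which tends to 2. *)
Lemma inv_succ_bloch_norm_ge (g : C -> C) :
  power_series_on_disc inv_succ g -> Rbar_le (Finite 3) (bloch_norm g).
Proof.
  intros Hg. unfold bloch_norm.
  rewrite (power_series_at_0 inv_succ g Hg).
  replace (Cmod (inv_succ 0)) with 1 by (unfold inv_succ; simpl; rewrite Cmod_pos_real; [field|left; apply Rinv_0_lt_compat; lra]).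
  match goal with |- Rbar_le _ (Rbar_plus _ (Lub_Rbar ?E)) => set (S := E) end.
  destruct (Lub_Rbar_correct S) as [Hub _].
  assert (Hd : forall d, 0 < d < 1 / 2 -> exists x, S x /\ (2 - d ^ 2) * (1 - 2 * d) <= x).
  { intros d Hd. assert (Hd2 : 0 < d ^ 2 < 1) by (simpl; nra).
    set (r := 1 - d ^ 2). assert (Hr : 0 < r < 1) by (unfold r; lra).
    assert (Dr : disc (RtoC r)) by (apply disc_real; lra).
    destruct (power_series_derivative inv_succ 1 Rle_0_1 Cmod_inv_succ g (RtoC r) Hg Dr) as [l [Hl Sl]].
    exists ((1 - Cmod (RtoC r) ^ 2) * Cmod (C_derive g (RtoC r))). split; [exists (RtoC r); auto|].
    rewrite (is_C_derive_unique g _ l Hl), Cmod_pos_real by lra.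
    assert (B := inv_succ_derivative_lower r d l Hr ltac:(lra) Sl).
    replace (1 - r) with (d ^ 2) in B by (unfold r; ring).
    assert (Hre := Rle_trans _ _ _ (Rle_abs (Re l)) (re_le_Cmod l)).
    replace (1 - r ^ 2) with ((2 - d ^ 2) * d ^ 2) by (unfold r; ring).
    rewrite Rmult_assoc. apply Rmult_le_compat_l; [lra|].
    replace (1 - 2 * d) with (d ^ 2 * ((1 - d) / d ^ 2 - / d)) by (field; lra).
    apply Rmult_le_compat_l; lra. }
  assert (Hge : Rbar_le (Finite 2) (Lub_Rbar S)).
  { destruct (Lub_Rbar S) as [L| |].
    - apply Rnot_lt_le; intros Hlt. simpl in Hlt.
      destruct (Hd (Rmin (1 / 4) ((2 - L) / 8))) as [x [Sx Hx]].
      { assert (M1 := Rmin_l (1 / 4) ((2 - L) / 8)). split; [apply Rmin_glb_lt; lra|lra]. }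
      assert (M1 := Rmin_l (1 / 4) ((2 - L) / 8)). assert (M2 := Rmin_r (1 / 4) ((2 - L) / 8)).
      assert (M0 : 0 < Rmin (1 / 4) ((2 - L) / 8)) by (apply Rmin_glb_lt; lra).
      set (d := Rmin _ _) in *. specialize (Hub x Sx). simpl in Hub, Hx. nra.
    - exact I.
    - destruct (Hd (1 / 4) ltac:(lra)) as [x [Sx _]]. destruct (Hub x Sx). }
  destruct (Lub_Rbar S) as [L| |]; simpl in Hge |- *; trivial; lra.
Qed.

Lemma analytic_const (c : C) : analytic (fun _ => c).
Proof.
  intros z _. exists (RtoC 0). apply bound_is_derive_C. intros eps He. exists 1; split; [lra|].
  intros w _. replace (c - c - 0 * (w - z))%C with (RtoC 0) by ring. rewrite Cmod_0.
  apply Rmult_le_pos; [lra|apply Cmod_ge_0].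
Qed.

Definition delta_seq (n : nat) : C := match n with O => RtoC 1 | S _ => RtoC 0 end.

Lemma is_series_delta (u : nat -> C) :
  @is_series C_AbsRing C_NormedModule (fun k => delta_seq k * u k)%C (u 0%nat).
Proof.
  apply bound_is_series_C. intros eps He. exists 0%nat. intros n _.
  assert (E : sum_n (fun k => delta_seq k * u k)%C n = u 0%nat).
  { induction n as [|n IH].
    - rewrite sum_O. simpl; ring.
    - rewrite sum_Sn, IH. unfold plus; simpl. ring. }
  rewrite E. replace (u 0%nat - u 0%nat)%C with (RtoC 0) by ring. rewrite Cmod_0; assumption.
Qed.

Lemma hilbert_one :
  hilbert (fun _ => RtoC 1) (fun z => csum (fun n => Cpow z n * inv_succ n)%C).
Proof.
  assert (Hg := power_series_converges inv_succ 1 Cmod_inv_succ).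
  split; [apply analytic_const|split].
  - exact (power_series_analytic inv_succ 1 Rle_0_1 Cmod_inv_succ _ Hg).
  - exists delta_seq, inv_succ. split; [|split; [|exact Hg]].
    + intros z _. apply is_pseries_C_iff.
      refine (is_series_ext _ _ _ _ (is_series_delta (Cpow z))). intros k; apply Cmult_comm.
    + intros n. assert (Hn := pos_INR n).
      replace (inv_succ n) with (/ RtoC (INR (n + 0 + 1)))%C.
      * exact (is_series_delta (fun k => / RtoC (INR (n + k + 1)))%C).
      * unfold inv_succ. rewrite Nat.add_0_r, plus_INR. simpl INR. symmetry; apply RtoC_inv; lra.
Qed.

Theorem theorem1p3 :
  (forall f : C -> C, in_Hinf f -> exists g : C -> C, hilbert f g /\ in_bloch g) /\
  (exists M : R, forall f g : C -> C, in_Hinf f -> hilbert f g ->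
     Rbar_le (bloch_norm g) (Rbar_mult (Finite M) (Hinf_norm f))) /\
  hilbert_op_norm = Finite 3.
Proof.
  split; [|split].
  - intros f Hf. destruct (Hinf_bound f Hf) as [M [_ [HM0 HM]]].
    destruct (hilbert_exists f M (proj1 Hf) HM0 HM) as [g Hg].
    exists g; split; [assumption|split; [apply Hg|]].
    apply Rbar_le_lt_trans with (Finite (3 * M)); [|exact I].
    exact (hilbert_bloch_norm_le f g M HM0 HM Hg).
  - exists 3. intros f g Hf Hg. destruct (Hinf_bound f Hf) as [M [E [HM0 HM]]].
    rewrite E. exact (hilbert_bloch_norm_le f g M HM0 HM Hg).
  - apply Rbar_is_lub_unique. split.
    + intros x [f [g [Hf [Hle [Hg ->]]]]]. destruct (Hinf_bound f Hf) as [M [E [HM0 HM]]].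
      rewrite E in Hle. simpl in Hle.
      apply Rbar_le_trans with (Finite (3 * M)); [exact (hilbert_bloch_norm_le f g M HM0 HM Hg)|].
      simpl; lra.
    + intros B HB.
      assert (Hone : Rbar_le (Hinf_norm (fun _ => RtoC 1)) (Finite 1)).
      { apply (proj2 (Lub_Rbar_correct _)). intros x [z [_ ->]]. rewrite Cmod_1. apply Rbar_le_refl. }
      eapply Rbar_le_trans; [|apply HB; exists (fun _ => RtoC 1); eexists; split; [|split; [exact Hone|split; [exact hilbert_one|reflexivity]]]].
      * apply inv_succ_bloch_norm_ge. exact (power_series_converges inv_succ 1 Cmod_inv_succ).
      * split; [apply analytic_const|]. apply Rbar_le_lt_trans with (Finite 1); [exact Hone|exact I].
Qed.
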